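(* In the model described in the context, assume $n_i\ge6$ for all $i$, fix $\upsilon\in(0,\infty)$, and suppose $\sum_{i=1}^aw_i\to\infty$ as $N\to\infty$ (this holds in each of the frameworks (I)–(V)). Then (a) $E(C_1^\star)=\operatorname{tr}((\boldsymbol T_S\boldsymbol\Sigma)^3)$; (b) with $\widehat f_P^\star:=\dfrac{A_2^3}{(C_1^\star)^2}\,\eta_{N,a}$, in each of the frameworks (I)–(V) one has $(\widehat f_P^\star)^{-1}-(f_P)^{-1}\to0$ in probability.
   Context: Model: there are $a$ independent groups; for $i=1,\dots,a$, $j=1,\dots,n_i$, $\boldsymbol X_{i,j}\sim\mathcal N_d(\boldsymbol\mu_i,\boldsymbol\Sigma)$ independent, $\boldsymbol\Sigma$ a common positive definite $d\times d$ matrix, $N=\sum_in_i$, $n_{\max}=\max_in_i$. $\boldsymbol T=\boldsymbol T_W\otimes\boldsymbol T_S$ with $\boldsymbol T_W$ ($a\times a$) and $\boldsymbol T_S$ ($d\times d$) nonzero symmetric idempotent matrices. $\boldsymbol V_N=\bigoplus_{i=1}^a\frac{N}{n_i}\boldsymbol\Sigma$, $f_P=\operatorname{tr}^3((\boldsymbol T\boldsymbol V_N)^2)/\operatorname{tr}^2((\boldsymbol T\boldsymbol V_N)^3)$, $\eta_{N,a}=\frac{\operatorname{tr}^3([\boldsymbol D\boldsymbol T_W]^2)}{\operatorname{tr}^2([\boldsymbol D\boldsymbol T_W]^3)}$ with $\boldsymbol D=\operatorname{diag}(N/n_1,\dots,N/n_a)$. $\boldsymbol Y_{i,\ell_1,\ell_2}=\boldsymbol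 T_S(\boldsymbol X_{i,\ell_1}-\boldsymbol X_{i,\ell_2})$. Subsampling: $w_i=\lceil\upsilon\binom{n_i}{6}\rceil$; for each $i$ and $b=1,\dots,w_i$ an ordered subsample $\boldsymbol\sigma_i(b)=(\sigma_{1i}(b),\dots,\sigma_{6i}(b))$ of 6 pairwise distinct indices from $\{1,\dots,n_i\}$ is drawn uniformly at random, independently over $i,b$ and of the data. With $\Lambda_1(\ell_1,\dots,\ell_6)=\boldsymbol Y_{i,\ell_1,\ell_2}^\top\boldsymbol Y_{i,\ell_3,\ell_4}$, $\Lambda_2=\boldsymbol Y_{i,\ell_3,\ell_4}^\top\boldsymbol Y_{i,\ell_5,\ell_6}$, $\Lambda_3=\boldsymbol Y_{i,\ell_5,\ell_6}^\top\boldsymbol Y_{i,\ell_1,\ell_2}$, define $C_{i,1}^\star=\sum_{b=1}^{w_i}\Lambda_1(\boldsymbol\sigma_i(b))\Lambda_2(\boldsymbol\sigma_i(b))\Lambda_3(\boldsymbol\sigma_i(b))$ and $C_1^\star=\frac{1}{8\sum_{i=1}^aw_i}\sum_{i=1}^aC_{i,1}^\star$. $A_2=\frac{1}{24\sum_i\binom{n_i}{4}}\sum_i\sum[(\boldsymbol X_{i,\ell_1}-\boldsymbol X_{i,\ell_2})^\top\boldsymbol T_S(\boldsymbol X_{i,k_1}-\boldsymbol X_{i,k_2})]^2$, the inner sum over pairwise distinct $\ell_1,\ell_2,k_1,k_2\in\{1,\dots,n_i\}$ with $\ell_1>\ell_2$, $k_1>k_2$. Asymptotic frameworks: all quantities may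 depend on an index along which $N\to\infty$, and one of the following holds (quantities not listed stay bounded): (I) $a\to\infty$; (II) $a,d\to\infty$; (III) $a,n_{\max}\to\infty$; (IV) $d,n_{\max}\to\infty$; (V) $a,d,n_{\max}\to\infty$. *)

(* Defs.v *)
From HB Require Import structures.
From mathcomp Require Import all_boot all_order all_algebra.
From mathcomp Require Import all_classical all_reals all_analysis.
Set Implicit Arguments. Unset Strict Implicit. Unset Printing Implicit Defensive.
Import Order.TTheory GRing.Theory Num.Theory.
Import numFieldNormedType.Exports.
Local Open Scope classical_set_scope.
Local Open Scope ring_scope.

Section LinAlg.
Context {R : realType}.

(* Kronecker product A (x) B; rows/columns of 'I_(m*n) identified with
   'I_m * 'I_n via the canonical enumeration (as in mxvec).  Traces, which
   is all we use, do not depend on this identification. *)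
Definition kronmx m n p q (A : 'M[R]_(m, p)) (B : 'M[R]_(n, q)) : 'M[R]_(m * n, p * q) :=
  \matrix_(k, l)
    (A (enum_val (cast_ord (esym (mxvec_cast m n)) k)).1
       (enum_val (cast_ord (esym (mxvec_cast p q)) l)).1 *
     B (enum_val (cast_ord (esym (mxvec_cast m n)) k)).2
       (enum_val (cast_ord (esym (mxvec_cast p q)) l)).2).

Definition dotv d (u v : 'cV[R]_d) : R := (u^T *m v) 0 0.

Definition sym_idem_nz n (M : 'M[R]_n) : Prop := [/\ M^T = M, M *m M = M & M != 0].

Definition posdef n (M : 'M[R]_n) : Prop :=
  M^T = M /\ forall u : 'cV[R]_n, u != 0 -> 0 < dotv u (M *m u).

End LinAlg.

Section Model.
Context {R : realType}.

Definition wsub (ups : R) a (n : 'I_a -> nat) (i : 'I_a) : nat :=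
  absz (Num.ceil (ups * ('C(n i, 6))%:R)).

Definition Ntot a (n : 'I_a -> nat) : nat := (\sum_(i < a) n i)%N.
Definition nmax a (n : 'I_a -> nat) : nat := (\max_(i < a) n i)%N.

Definition Dmat a (n : 'I_a -> nat) : 'M[R]_a :=
  diag_mx (\row_i ((Ntot n)%:R / (n i)%:R)).

(* f_P = tr^3((T V_N)^2) / tr^2((T V_N)^3), T = T_W (x) T_S,
   V_N = (+)_i (N/n_i) Sigma = D (x) Sigma *)
Definition fP a d (n : 'I_a -> nat) (TW : 'M[R]_a) (TS Sig : 'M[R]_d) : R :=
  let TV := kronmx TW TS *m kronmx (Dmat n) Sig in
  (\tr (TV *m TV)) ^+ 3 / (\tr (TV *m TV *m TV)) ^+ 2.

Definition eta_Na a (n : 'I_a -> nat) (TW : 'M[R]_a) : R :=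
  let DT := Dmat n *m TW in
  (\tr (DT *m DT)) ^+ 3 / (\tr (DT *m DT *m DT)) ^+ 2.

Context {T : Type}.
Variables (a d : nat) (n : 'I_a -> nat) (ups : R) (TS : 'M[R]_d).
Unset Implicit Arguments.
Variable X : forall i : 'I_a, 'I_(n i) -> 'I_d -> T -> R.
Variable sig : forall i : 'I_a, 'I_(wsub ups n i) -> T -> {ffun 'I_6 -> 'I_(n i)}.
Set Implicit Arguments.

Definition vecX i (j : 'I_(n i)) (t : T) : 'cV[R]_d := \col_k X i j k t.

Definition Yv i (l1 l2 : 'I_(n i)) (t : T) : 'cV[R]_d :=
  TS *m (vecX l1 t - vecX l2 t).

Definition o6 (k : nat) : 'I_6 := inord k.

Definition Lam123 i (l : {ffun 'I_6 -> 'I_(n i)}) (t : T) : R :=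
  let Y12 := Yv (l (o6 0)) (l (o6 1)) t in
  let Y34 := Yv (l (o6 2)) (l (o6 3)) t in
  let Y56 := Yv (l (o6 4)) (l (o6 5)) t in
  dotv Y12 Y34 * dotv Y34 Y56 * dotv Y56 Y12.

Definition C1star_i i (t : T) : R :=
  \sum_(b < wsub ups n i) Lam123 (sig i b t) t.

Definition C1star (t : T) : R :=
  (8 * (\sum_(i < a) (wsub ups n i)%:R))^-1 * \sum_(i < a) C1star_i i t.

Definition A2 (t : T) : R :=
  (24 * \sum_(i < a) ('C(n i, 4))%:R)^-1 *
  \sum_(i < a) \sum_(l1 < n i) \sum_(l2 < n i) \sum_(k1 < n i)
    \sum_(k2 < n i | [&& uniq [:: l1; l2; k1; k2], (l2 < l1)%N & (k2 < k1)%N])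
      (dotv (vecX l1 t - vecX l2 t) (TS *m (vecX k1 t - vecX k2 t))) ^+ 2.

Definition fPhat_star (TW : 'M[R]_a) (t : T) : R :=
  A2 t ^+ 3 / (C1star t) ^+ 2 * eta_Na n TW.

End Model.

Section Hyp.
Context {R : realType} {dT : measure_display} {T : measurableType dT}.
Variables (P : probability T R) (a d : nat) (n : 'I_a -> nat)
  (mu : 'I_a -> 'cV[R]_d) (Sig TS : 'M[R]_d) (TW : 'M[R]_a) (ups : R).
Unset Implicit Arguments.
Variable X : forall i : 'I_a, 'I_(n i) -> 'I_d -> T -> R.
Variable sig : forall i : 'I_a, 'I_(wsub ups n i) -> T -> {ffun 'I_6 -> 'I_(n i)}.
Set Implicit Arguments.

Definition sigmaX i (j : 'I_(n i)) : set (set T) :=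
  <<s [set A | exists k (B : set R), measurable B /\ A = X i j k @^-1` B] >>.

Definition sigmaS i (b : 'I_(wsub ups n i)) : set (set T) :=
  <<s [set A | exists s, A = [set t | sig i b t = s]] >>.

Definition rv_index := ({i : 'I_a & 'I_(n i)} + {i : 'I_a & 'I_(wsub ups n i)})%type.

Definition sigma_family (j : rv_index) : set (set T) :=
  match j with
  | inl p => sigmaX (tagged p)
  | inr p => sigmaS (tagged p)
  end.

Definition mutually_independent : Prop :=
  forall A : rv_index -> set T, (forall j, sigma_family j (A j)) ->
    P (\bigcap_j A j) = (\prod_(j : rv_index) P (A j))%E.

(* X ~ N_d(m, S): every nontrivial linear combination u^T X is
   N(u^T m, u^T S u) (Cramer-Wold definition). *)
Definition gaussian_vec (Xv : T -> 'cV[R]_d) (m : 'cV[R]_d) (S : 'M[R]_d) : Prop :=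
  forall u : 'cV[R]_d, u != 0 -> forall B : set R, measurable B ->
    P ((fun t => dotv u (Xv t)) @^-1` B) =
    normal_prob (dotv u m) (Num.sqrt (dotv u (S *m u))) B.

Definition uniform_subsample i (s_ : T -> {ffun 'I_6 -> 'I_(n i)}) : Prop :=
  forall s : {ffun 'I_6 -> 'I_(n i)},
    measurable [set t | s_ t = s] /\
    P [set t | s_ t = s] =
      (if injectiveb s
       then (#|[set s' : {ffun 'I_6 -> 'I_(n i)} | injectiveb s']|%:R)^-1
       else 0)%:E.

Definition model_hyp : Prop :=
  [/\ (forall i, 6 <= n i)%N, 0 < ups, sym_idem_nz TW, sym_idem_nz TS & posdef Sig] /\
  [/\ (forall i j k, measurable_fun setT (X i j k)),
      (forall i (j : 'I_(n i)), gaussian_vec (vecX X j) (mu i) Sig),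
      (forall i b, uniform_subsample (sig i b)) &
      mutually_independent].

End Hyp.

Definition diverges (u : nat -> nat) : Prop := forall M : nat, \forall k \near \oo, (M <= u k)%N.
Definition bounded_seq (u : nat -> nat) : Prop := exists M : nat, forall k, (u k <= M)%N.

Inductive framework := FI | FII | FIII | FIV | FV.

(* a, d, nmax as functions of the index k; unlisted quantities stay bounded *)
Definition in_framework (F : framework) (a d nm : nat -> nat) : Prop :=
  match F with
  | FI   => [/\ diverges a, bounded_seq d & bounded_seq nm]
  | FII  => [/\ diverges a, diverges d & bounded_seq nm]
  | FIII => [/\ diverges a, diverges nm & bounded_seq d]
  | FIV  => [/\ diverges d, diverges nm & bounded_seq a]
  | FV   => [/\ diverges a, diverges d & diverges nm]
  end.

(* Main.v *)
Require Import Defs.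
From HB Require Import structures.
From mathcomp Require Import all_boot all_order all_algebra.
From mathcomp Require Import ring lra zify.
From mathcomp Require Import all_classical all_reals all_analysis.
From mathcomp Require Import measurable_realfun.
Set Implicit Arguments. Unset Strict Implicit. Unset Printing Implicit Defensive.
Import Order.TTheory GRing.Theory Num.Theory.
Import numFieldNormedType.Exports.
Local Open Scope classical_set_scope.
Local Open Scope ring_scope.

(** With [M = TS Sig TS], [t2 = tr M^2] and
    [t3 = tr M^3], both estimators are averages of kernels that depend on the data
    only through inner products of the projected centred observations
    [TS (X_ij - mu_i)], and they are unbiased for [t3] and [t2].  Kernels on
    disjoint index sets are uncorrelated, and two subsamples of a group of size
    [n_i] overlap with probability [O(1 / n_i)], so the relative variances are of
    order [sum_i w_i^2 / n_i / (sum_i w_i)^2 + 1 / sum_i w_i] for [C1star] and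
    [sum_i n_i^7 / (sum_i n_i^4)^2] for [A2].  As [w_i = O(n_i^6)], both vanish when
    [sum_i w_i -> oo].  The kernels have second moments [O(t2^3)] and [O(t2^2)]:
    given one factor, an inner product is Gaussian, and a Cholesky factor of [M]
    reduces the remaining quadratic form to sixth moments of linear forms.  Finally
    [t3^2 <= t2^3] and [1 / eta_Na <= 1] turn the two relative errors into an
    absolute error of [1 / f_P]. *)

(** * Integration against a density and functions with all moments *)

(** Independence is given for events only, while the kernels need expectations of products of
    polynomials in many observations. No product space is built: factorisation is proved for
    products with one function per component and extended by bilinearity to the sums of such
    products that [pol] describes. The kernels are polynomials, so they belong to this class, and
    even freezing one factor of an inner product becomes an identity between finite sums.

    The random subsamples disappear in the same spirit: [C1star] becomes a sum over all ordered
    tuples, each weighted by the number of times it is drawn. These counts are independent of the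
    data and add up to a constant, so [A2], whose weights are constants, obeys the same variance
    inequality.

    The scale of the errors matters at the end. As [t3] can be far smaller than [t2 ^ (3 / 2)],
    [C1star] need not be accurate relative to [t3]; its error is measured against [t2 ^ (3 / 2)],
    which suffices because [t2 ^ 3] is the divisor in [1 / f_P]. *)

Section Density.
Local Open Scope ereal_scope.
Context d1 d2 (X : measurableType d1) (Y : measurableType d2) (R : realType).
Variables (phi : X -> Y) (mphi : measurable_fun setT phi).
Variables (mu : {measure set X -> \bar R}) (nu : {measure set Y -> \bar R}).
Variables (w : X -> R) (mw : measurable_fun setT w) (w0 : forall x, (0 <= w x)%R).
Hypothesis nuE : forall B, measurable B -> nu B = \int[mu]_(x in phi @^-1` B) (w x)%:E.

Import HBNNSimple.

(** Simple functions and monotone convergence extend [nuE] from sets to functions. Two uses: [phi]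
    one of several independent factors with [w] the product of the others, and [phi] the identity
    with [w] the normal density. *)
Lemma ge0_integral_density (g : Y -> \bar R) :
  measurable_fun setT g -> (forall y, 0 <= g y) ->
  \int[nu]_y g y = \int[mu]_x (g (phi x) * (w x)%:E).
Proof.
move=> mg g0.
have mpre B : measurable B -> measurable (phi @^-1` B).
  by move=> mB; rewrite -[_ @^-1` _]setTI; exact: mphi.
pose f_ := nnsfun_approx measurableT mg.
have fcvg y : EFin (f_ n y) @[n --> \oo] --> g y.
  by apply: cvg_nnsfun_approx.
have fw_nd x : nondecreasing_seq (fun n => (f_ n (phi x))%:E * (w x)%:E).
  move=> m n mn; apply: lee_wpmul2r; first by rewrite lee_fin.
  by rewrite lee_fin; exact/lefP/nd_nnsfun_approx.
transitivity (limn (fun n => \int[nu]_x (f_ n x)%:E)).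
  rewrite -monotone_convergence//.
  - by apply: eq_integral => y _; apply/esym/cvg_lim.
  - by move=> n; exact/measurable_EFinP/measurable_funP.
  - by move=> n y _; rewrite lee_fin.
  - by move=> y _ m n mn; rewrite lee_fin; exact/lefP/nd_nnsfun_approx.
rewrite [X in limn X](_ : _ =
    (fun n => \int[mu]_x ((f_ n (phi x))%:E * (w x)%:E))).
  rewrite -monotone_convergence//; last 2 first.
  - move=> n; apply: emeasurable_funM; last exact/measurable_EFinP.
    by apply/measurable_EFinP; apply: measurableT_comp.
  - by move=> n x _; rewrite mule_ge0 ?lee_fin//.
  apply: eq_integral => x _; apply/cvg_lim => //.
  exact: cvgeZr (fcvg _).
apply/funext => n.
under [RHS]eq_integral do rewrite fimfunE -fsumEFin//.
transitivity (\int[mu]_x \sum_(k \in range (f_ n)) ((k * \1_(f_ n @^-1` [set k]) (phi x))%:E * (w x)%:E)).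
  rewrite ge0_integral_fsum//; last 2 first.
  - move=> y; apply: emeasurable_funM; last exact/measurable_EFinP; apply/measurable_EFinP.
    apply: measurable_funM => //; apply: (measurableT_comp _ mphi).
    exact: measurable_indic.
  - move=> y x _; rewrite mule_ge0 ?lee_fin//.
    by have := nnfun_muleindic_ge0 (f_ n) y (phi x); rewrite lee_fin.
  under [LHS]eq_integral do rewrite fimfunE -fsumEFin//.
  rewrite ge0_integral_fsum//; last 2 first.
  - by move=> y; exact/measurable_EFinP/measurable_funM.
  - by move=> y x _; rewrite nnfun_muleindic_ge0.
  apply: eq_fsbigr => r _; rewrite integralZl_indic_nnsfun// integral_indic//= setIT.
  rewrite nuE//.
  have [r0|r0] := ltP r 0%R.
    rewrite preimage_nnfun0// preimage_set0 integral_set0 mule0.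
    by rewrite integral0_eq// => x _; rewrite indic0 mulr0 mul0e.
  under [RHS]eq_integral do rewrite EFinM -muleA.
  rewrite ge0_integralZl//; last first.
  - by move=> x _; rewrite mule_ge0 ?lee_fin//.
  - apply: emeasurable_funM; last exact/measurable_EFinP; apply/measurable_EFinP/(measurableT_comp _ mphi).
    exact: measurable_indic.
  congr (_ * _).
  rewrite integral_mkcond; apply: eq_integral => x _.
  rewrite patchE indicE.
  rewrite (_ : (phi x \in f_ n @^-1` [set r]) = (x \in phi @^-1` (f_ n @^-1` [set r]))); last first.
    by apply/idP/idP; rewrite !inE.
  by case: (x \in _); rewrite ?mul1e ?mul0e.
apply: eq_integral => x _.
rewrite -ge0_mule_fsuml//.
by move=> y; exact: nnfun_muleindic_ge0.
Qed.

End Density.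

Section Moments.
Context {R : realType} {dT : measure_display} {T : measurableType dT}.
Variable P : probability T R.
Implicit Types f g : T -> R.

Definition Ex (f : T -> R) : R := (\int[P]_x f x)%R.

(** Unlike integrability, this property is stable under products, so every integrability side
    condition below follows from closure lemmas. *)
Definition all_moments (f : T -> R) : Prop :=
  measurable_fun setT f /\
  forall p, P.-integrable setT (EFin \o (fun x => `|f x| ^+ p)).

Lemma all_moments_measurable f : all_moments f -> measurable_fun setT f.
Proof. by case. Qed.

Lemma all_moments_int f : all_moments f -> P.-integrable setT (EFin \o f).
Proof.
move=> [mf /(_ 1%N)]; apply: le_integrable => //; first exact/measurable_EFinP.
by move=> x _ /=; rewrite lee_fin normr_id.
Qed.

Lemma all_moments_le f g : measurable_fun setT f -> (forall x, `|f x| <= `|g x|) ->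
  all_moments g -> all_moments f.
Proof.
move=> mf fg [_ ig]; split => // p; apply: le_integrable (ig p) => //.
  by apply/measurable_EFinP/measurable_funX; exact: measurableT_comp.
move=> x _ /=; rewrite lee_fin !normrX !normr_id.
by rewrite lerXn2r// nnegrE.
Qed.

Lemma all_moments_cst c : all_moments (fun=> c).
Proof.
split; first exact: measurable_cst.
by move=> p; apply: (finite_measure_integrable_cst P (`|c| ^+ p)).
Qed.

Lemma normrM_le_sum (x y : R) p :
  `|x * y| ^+ p <= `|x| ^+ (p * 2) + `|y| ^+ (p * 2).
Proof.
rewrite normrM exprMn 2!exprM.
move: (`|x| ^+ p) (`|y| ^+ p) => a b; have := sqr_ge0 (a - b); have := sqr_ge0 (a + b); nra.
Qed.

Lemma normrD_le_sum (x y : R) p :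
  `|x + y| ^+ p <= 2 ^+ p * (`|x| ^+ p + `|y| ^+ p).
Proof.
have [xy|yx] := leP `|x| `|y|.
  apply: (@le_trans _ _ (2 ^+ p * `|y| ^+ p)); last first.
    by rewrite ler_wpM2l ?exprn_ge0// lerDr exprn_ge0.
  rewrite -exprMn lerXn2r ?nnegrE ?mulr_ge0//.
  by rewrite (le_trans (ler_normD _ _))// mulr_natl mulr2n lerD2r.
apply: (@le_trans _ _ (2 ^+ p * `|x| ^+ p)); last first.
  by rewrite ler_wpM2l ?exprn_ge0// lerDl exprn_ge0.
rewrite -exprMn lerXn2r ?nnegrE ?mulr_ge0//.
by rewrite (le_trans (ler_normD _ _))// mulr_natl mulr2n lerD2l ltW.
Qed.

Lemma all_momentsM f g : all_moments f -> all_moments g ->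
  all_moments (fun x => f x * g x).
Proof.
move=> [mf lf] [mg ig]; split; first exact: measurable_funM.
move=> p; apply: (@le_integrable _ _ _ P _ measurableT _
   (fun x => (EFin \o (fun x => `|f x| ^+ (p * 2))%R) x + (EFin \o (fun x => `|g x| ^+ (p * 2))%R) x)%E).
- by apply/measurable_EFinP/measurable_funX; apply: measurableT_comp => //; exact: measurable_funM.
- move=> x _ /=; rewrite lee_fin normrX normr_id (le_trans (normrM_le_sum _ _ _))//.
  exact: ler_norm.
- exact: integrableD.
Qed.

Lemma all_momentsD f g : all_moments f -> all_moments g ->
  all_moments (fun x => f x + g x).
Proof.
move=> [mf lf] [mg ig]; split; first exact: measurable_funD.
move=> p; apply: (@le_integrable _ _ _ P _ measurableT _
   (fun x => (2 ^+ p)%:E * ((EFin \o (fun x => `|f x| ^+ p)%R) x + (EFin \o (fun x => `|g x| ^+ p)%R) x))%E).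
- by apply/measurable_EFinP/measurable_funX; apply: measurableT_comp => //; exact: measurable_funD.
- move=> x _ /=; rewrite lee_fin normrX normr_id (le_trans (normrD_le_sum _ _ _))//.
  exact: ler_norm.
- by apply: integrableZl => //; exact: integrableD.
Qed.

Lemma all_momentsZ c f : all_moments f -> all_moments (fun x => c * f x).
Proof. exact/all_momentsM/all_moments_cst. Qed.

Lemma all_momentsB f g : all_moments f -> all_moments g ->
  all_moments (fun x => f x - g x).
Proof.
move=> mf mg; rewrite (_ : (fun x => _) = (fun x => f x + (-1) * g x)).
  exact/all_momentsD/all_momentsZ.
by apply/funext => x; rewrite mulN1r.
Qed.

Lemma all_moments_sum I (r : seq I) (Q : pred I) (f : I -> T -> R) :
  (forall i, Q i -> all_moments (f i)) ->
  all_moments (fun x => \sum_(i <- r | Q i) f i x).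
Proof.
move=> mf; elim: r => [|i r ih].
  rewrite (_ : (fun x => _) = fun=> 0); first exact: all_moments_cst.
  by apply/funext => x; rewrite big_nil.
have [Qi|nQi] := boolP (Q i); last first.
  by rewrite (funext (fun x => big_cons _ _ _ _ _ _)) (negbTE nQi).
rewrite (funext (fun x => big_cons _ _ _ _ _ _)) Qi.
by apply: all_momentsD => //; exact: mf.
Qed.

Lemma all_moments_prod I (r : seq I) (Q : pred I) (f : I -> T -> R) :
  (forall i, Q i -> all_moments (f i)) ->
  all_moments (fun x => \prod_(i <- r | Q i) f i x).
Proof.
move=> mf; elim: r => [|i r ih].
  rewrite (_ : (fun x => _) = fun=> 1); first exact: all_moments_cst.
  by apply/funext => x; rewrite big_nil.
have [Qi|nQi] := boolP (Q i); last first.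
  by rewrite (funext (fun x => big_cons _ _ _ _ _ _)) (negbTE nQi).
rewrite (funext (fun x => big_cons _ _ _ _ _ _)) Qi.
by apply: all_momentsM => //; exact: mf.
Qed.

Lemma all_momentsX f p : all_moments f -> all_moments (fun x => f x ^+ p).
Proof.
move=> mf; rewrite (_ : (fun x => _) = (fun x => \prod_(i < p) f x)).
  exact: all_moments_prod.
by apply/funext => x; rewrite prodr_const card_ord.
Qed.

Lemma EFin_Ex f : all_moments f -> (\int[P]_x (f x)%:E)%E = (Ex f)%:E.
Proof.
move=> mf; rewrite /Ex /Rintegral fineK//.
exact: (integrable_fin_num _ (all_moments_int mf)).
Qed.

Lemma Ex_cst c : Ex (fun=> c) = c.
Proof. by rewrite /Ex Rintegral_cst//= probability_setT mulr1. Qed.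

Lemma ExD f g : all_moments f -> all_moments g -> Ex (fun x => f x + g x) = Ex f + Ex g.
Proof. by move=> /all_moments_int mf /all_moments_int mg; exact: RintegralD. Qed.

Lemma ExZ c f : all_moments f -> Ex (fun x => c * f x) = c * Ex f.
Proof. by move=> /all_moments_int mf; exact: RintegralZl. Qed.

Lemma ExB f g : all_moments f -> all_moments g -> Ex (fun x => f x - g x) = Ex f - Ex g.
Proof. by move=> /all_moments_int mf /all_moments_int mg; exact: RintegralB. Qed.

Lemma Ex_sum I (r : seq I) (Q : pred I) (f : I -> T -> R) :
  (forall i, Q i -> all_moments (f i)) ->
  Ex (fun x => \sum_(i <- r | Q i) f i x) = \sum_(i <- r | Q i) Ex (f i).
Proof.
move=> mf; elim: r => [|i r ih].
  by rewrite (funext (fun x => big_nil _ _ _ _)) Ex_cst big_nil.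
rewrite (funext (fun x => big_cons _ _ _ _ _ _)) big_cons.
case: ifPn => // Qi; rewrite ExD ?ih//; first exact: mf.
exact: all_moments_sum.
Qed.

Lemma Ex_le f g : all_moments f -> all_moments g -> (forall x, f x <= g x) -> Ex f <= Ex g.
Proof.
by move=> /all_moments_int mf /all_moments_int mg fg; exact: le_Rintegral.
Qed.

Lemma Ex_ge0 f : (forall x, 0 <= f x) -> 0 <= Ex f.
Proof. by move=> f0; exact: Rintegral_ge0. Qed.

Lemma markov_ineq f (c : R) : all_moments f -> (forall x, 0 <= f x) -> 0 < c ->
  (P [set x | (c <= f x)%R] <= (c^-1 * Ex f)%:E)%E.
Proof.
move=> mf f0 c0.
have mf' := all_moments_measurable mf.
have mA : measurable [set x | c <= f x].
  rewrite (_ : [set x | _] = f @^-1` `[c, +oo[); last first.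
    by apply/seteqP; split => x /=; rewrite in_itv/= andbT.
  by rewrite -[_ @^-1` _]setTI; exact: mf'.
rewrite EFinM -(EFin_Ex mf) -ge0_integralZl//; last 3 first.
- exact/measurable_EFinP.
- by move=> x _; rewrite lee_fin.
- by rewrite lee_fin invr_ge0 ltW.
rewrite -[X in P X]setIT -integral_indic//; apply: ge0_le_integral => //.
- exact/measurable_EFinP/measurable_indic.
- by apply/measurable_EFinP; apply: measurable_funM.
move=> x _; rewrite -EFinM lee_fin indicE; case: (boolP (x \in _)).
  by rewrite inE/= ler_pdivlMl// mulr1.
by rewrite mulr_ge0// invr_ge0 ltW.
Qed.

End Moments.

(** * Independence *)

Section Independence.
Context {R : realType} {dT : measure_display} {T : measurableType dT}.
Variable P : probability T R.
Variables (I : finType) (G : I -> set (set T)).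
Hypothesis sub_meas : forall j A, <<s G j >> A -> measurable A.
Hypothesis indepG : forall A : I -> set T, (forall j, <<s G j >> (A j)) ->
  P (\bigcap_j A j) = (\prod_(j : I) P (A j))%E.

Implicit Types f g : T -> R.

Definition adapted (j : I) f : Prop :=
  measurable_fun (setT : set (g_sigma_algebraType (G j))) f.

Lemma adapted_preimage j f B : adapted j f -> measurable B -> <<s G j >> (f @^-1` B).
Proof. by move=> af mB; have := af measurableT B mB; rewrite setTI. Qed.

Lemma adapted_indic j A : <<s G j >> A -> adapted j (\1_A).
Proof. by move=> GA; apply: (@measurable_indic _ (g_sigma_algebraType (G j))). Qed.

Lemma all_moments_indic (A : set T) : measurable A -> all_moments P (\1_A).
Proof.
move=> mA; apply: (@all_moments_le _ _ _ _ _ (fun=> 1)).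
- exact: measurable_indic.
- by move=> x; rewrite indicE normr1; case: (_ \in _); rewrite ?normr1 ?normr0.
- exact: all_moments_cst.
Qed.

Lemma Ex_indic (A : set T) : measurable A -> Ex P (\1_A) = fine (P A).
Proof. by move=> mA; rewrite /Ex /Rintegral integral_indic// setIT. Qed.

Lemma prod_EFinE (J : finType) (Q : pred J) (F : J -> R) :
  (\prod_(j | Q j) (F j)%:E)%E = (\prod_(j | Q j) F j)%:E.
Proof. by apply/esym/(big_morph EFin) => // x y; rewrite EFinM. Qed.

Lemma prod_indic (A : I -> set T) x :
  \prod_j \1_(A j) x = \1_(\bigcap_j A j) x :> R.
Proof.
rewrite indicE; case: (boolP (x \in _)) => [|/negP h].
  by rewrite inE => h; rewrite big1// => j _; rewrite indicE mem_set//; exact: h.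
have [j nj] : exists j, ~ A j x.
  by apply/existsNP => h'; apply: h; rewrite inE => j _; exact: h'.
by rewrite (bigD1 j)//= indicE memNset// mul0r.
Qed.

(* The factors are replaced one at a time: with all other factors fixed, the
   law of [f j0] under the density [\prod_(j != j0) f j] is a multiple of its
   law under [P]. *)
Lemma indep_ge0_aux (r : seq I) (f : I -> T -> R) :
  (forall j, all_moments P (f j)) -> (forall j x, 0 <= f j x) ->
  (forall j, adapted j (f j)) ->
  (forall j, j \notin r -> exists2 A, <<s G j >> A & f j = \1_A) ->
  (\int[P]_x (\prod_j f j x)%:E)%E = (\prod_j Ex P (f j))%:E.
Proof.
elim: r f => [|j0 r ih] f mf f0 af hr.
  have /choice[A hA] : forall j, exists A, <<s G j >> A /\ f j = \1_A.
    by move=> j; have [//|A GA fA] := hr j; exists A.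
  have mA j : measurable (A j) by have [/sub_meas] := hA j.
  under eq_integral.
    move=> x _; under eq_bigr do rewrite (hA _).2.
    rewrite prod_indic; over.
  rewrite integral_indic ?setIT//; last first.
    by apply: fin_bigcap_measurable => //; exact: finite_finset.
  rewrite /= indepG; last by move=> j; have [] := hA j.
  rewrite -prod_EFinE; apply: eq_bigr => j _.
  by rewrite (hA j).2 Ex_indic// fineK// fin_num_measure.
pose c := \prod_(j | j != j0) Ex P (f j).
have c0 : 0 <= c by apply: prodr_ge0 => j _; exact: Ex_ge0.
pose w x := \prod_(j | j != j0) f j x.
have mw : all_moments P w by exact: all_moments_prod.
have w0 x : 0 <= w x by exact: prodr_ge0.
have key B : measurable B ->
    (c%:E * P (f j0 @^-1` B))%E = (\int[P]_(x in f j0 @^-1` B) (w x)%:E)%E.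
  move=> mB; have GB := adapted_preimage (af j0) mB.
  (* Replacing the factor [j0] by an indicator puts the family within reach of the induction
     hypothesis for [r]. *)
  pose f' j := if j == j0 then \1_(f j0 @^-1` B) else f j.
  have E1 : \prod_j Ex P (f' j) = c * fine (P (f j0 @^-1` B)).
    rewrite (bigD1 j0)//= mulrC; congr (_ * _).
      by apply: eq_bigr => j /negbTE jj0; rewrite /f' jj0.
    by rewrite /f' eqxx Ex_indic//; exact: sub_meas GB.
  have E2 x : \prod_j f' j x = \1_(f j0 @^-1` B) x * w x.
    rewrite (bigD1 j0)//= /f' eqxx; congr (_ * _).
    by apply: eq_bigr => j /negbTE ->.
  transitivity (\prod_j Ex P (f' j))%:E.
    by rewrite E1 EFinM fineK//; apply: fin_num_measure; exact: sub_meas GB.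
  rewrite -(ih f').
  - rewrite [RHS]integral_mkcond; apply: eq_integral => x _.
    by rewrite patchE E2 indicE; case: (x \in _); rewrite ?mul1r ?mul0r.
  - move=> j; rewrite /f'; case: eqP => // _.
    exact/all_moments_indic/(sub_meas GB).
  - by move=> j x; rewrite /f'; case: eqP.
  - move=> j; rewrite /f'; case: eqP => // ->; exact: adapted_indic.
  - move=> j jr; rewrite /f'; case: eqP => [->|/eqP jj0].
      by exists (f j0 @^-1` B).
    by apply: hr; rewrite inE negb_or jj0.
have mf0 := all_moments_measurable (mf j0).
pose X : {RV P >-> R} := mfun_Sub (mem_set mf0).
pose nu : {measure set R -> \bar R} := mscale (NngNum c0) (distribution P X).
have nuE B : measurable B -> nu B = (\int[P]_(x in f j0 @^-1` B) (w x)%:E)%E.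
  exact: key.
(* The density lemma wants a test function that is nonnegative on all of [R]; the absolute value
   agrees with the identity on the range of [f j0]. *)
have mabs : measurable_fun setT (fun y : R => `|y|%:E).
  by apply/measurable_EFinP; exact: normr_measurable.
have := ge0_integral_density mf0 (all_moments_measurable mw) w0 nuE mabs.
move=> /(_ (fun y => ltac:(by rewrite lee_fin))).
rewrite ge0_integral_mscale//.
rewrite ge0_integral_distribution//.
move=> e.
rewrite (bigD1 j0)//= mulrC EFinM -/c.
transitivity (\int[P]_x (`|f j0 x|%:E * (w x)%:E))%E.
  by apply: eq_integral => x _; rewrite (bigD1 j0)//= EFinM ger0_norm.
rewrite -e; congr (_ * _)%E; rewrite -EFin_Ex//.
by apply: eq_integral => x _ /=; rewrite ger0_norm.
Qed.

(** The list [r] holds the factors still allowed to change sign. Both sides are linear in each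
    factor, so splitting one of them into positive and negative parts shortens the list. *)
Lemma Ex_prod_indep_signed (r : seq I) (f : I -> T -> R) :
  (forall j, all_moments P (f j)) -> (forall j, adapted j (f j)) ->
  (forall j, j \notin r -> forall x, 0 <= f j x) ->
  Ex P (fun x => \prod_j f j x) = \prod_j Ex P (f j).
Proof.
elim: r f => [|j0 r ih] f mf af hr.
  apply: EFin_inj; rewrite -EFin_Ex; last exact: all_moments_prod.
  apply: (@indep_ge0_aux (enum I)) => //; first by move=> j; exact: hr.
  by move=> j; rewrite mem_enum.
(* [f1 true] carries the positive part of the factor [j0], [f1 false] its negative part. *)
pose f1 (e : bool) j := if j == j0 then fun x => Num.max (if e then f j x else - f j x) 0 else f j.
have mf1 e j : all_moments P (f1 e j).
  rewrite /f1; case: eqP => // _; apply: (all_moments_le _ _ (mf j)).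
    apply: measurable_maxr; last exact: measurable_cst.
    have mm := all_moments_measurable (mf j).
    by case: e => //; apply: measurableT_comp mm.
  by move=> x /=; case: e; [case: (leP (f j x) 0)|case: (leP (- f j x) 0)] => _;
    rewrite ?normr0 ?normrN ?normr_ge0 ?lexx.
have h e : Ex P (fun x => \prod_j f1 e j x) = \prod_j Ex P (f1 e j).
  apply: ih => //.
    move=> j; rewrite /f1; case: eqP => // _.
    apply: (@measurable_maxr _ (g_sigma_algebraType (G j))); last exact: measurable_cst.
    by have := af j; case: e => // a; exact: (measurableT_comp _ a).
  move=> j jr x; rewrite /f1; case: eqP => [_|/eqP jj0]; first by rewrite le_max lexx orbT.
  by apply: hr; rewrite inE negb_or jj0.
have rest e x : \prod_(j | j != j0) f1 e j x = \prod_(j | j != j0) f j x.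
  by apply: eq_bigr => j /negbTE jj0; rewrite /f1 jj0.
have rest' e : \prod_(j | j != j0) Ex P (f1 e j) = \prod_(j | j != j0) Ex P (f j).
  by apply: eq_bigr => j /negbTE jj0; rewrite /f1 jj0.
have dec x : f j0 x = f1 true j0 x - f1 false j0 x.
  by rewrite /f1 eqxx; case: (leP (f j0 x) 0); case: (leP (- f j0 x) 0) => *; lra.
transitivity (Ex P (fun x => \prod_j f1 true j x - \prod_j f1 false j x)).
  congr Ex; apply/funext => x.
  by rewrite !(bigD1 j0 (P := predT))//= !rest -mulrBl -dec.
rewrite ExB; [|exact: all_moments_prod..].
rewrite !h !(bigD1 j0 (P := predT))//= !rest' -mulrBl -ExB//.
by congr (Ex P _ * _); apply/funext => x; rewrite -dec.
Qed.

Lemma Ex_prod_indep (f : I -> T -> R) :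
  (forall j, all_moments P (f j)) -> (forall j, adapted j (f j)) ->
  Ex P (fun x => \prod_j f j x) = \prod_j Ex P (f j).
Proof.
move=> mf af; apply: (@Ex_prod_indep_signed (enum I)) => // j.
by rewrite mem_enum.
Qed.

(* [pol A] replaces the functions measurable with respect to the components in [A]:
   it makes independence of disjoint groups a computation with products. *)
Inductive pol (A : {set I}) : (T -> R) -> Prop :=
| pol_prod (c : R) (f : I -> T -> R) of (forall j, all_moments P (f j)) & (forall j, adapted j (f j)) &
    (forall j, j \notin A -> f j = fun=> 1) : pol A (fun x => c * \prod_j f j x)
| polD f g of pol A f & pol A g : pol A (fun x => f x + g x).

Lemma pol_all_moments A f : pol A f -> all_moments P f.
Proof.
by elim=> [c {}f mf _ _|{}f g _ mf _ mg]; [exact/all_momentsZ/all_moments_prod|exact: all_momentsD].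
Qed.

Lemma polS (A B : {set I}) f : A \subset B -> pol A f -> pol B f.
Proof.
move=> AB; elim=> [c {}f mf af h|{}f g _ pf _ pg]; last exact: polD.
by apply: pol_prod => // j jB; apply: h; apply: contra jB; exact: (fintype.subsetP AB).
Qed.

Lemma pol1 j f : all_moments P f -> adapted j f -> pol [set j] f.
Proof.
move=> mf af.
rewrite (_ : f = fun x => 1 * \prod_i (if i == j then f else fun=> 1) x); last first.
  apply/funext => x; rewrite (bigD1 j)//= eqxx mul1r big1 ?mulr1// => i /negbTE ->//.
apply: pol_prod => [i|i|i].
- by case: eqP => // _; exact: all_moments_cst.
- by case: eqP => [->//|_]; exact: measurable_cst.
- by rewrite inE => /negbTE ->.
Qed.

Lemma pol_cst A c : pol A (fun=> c).
Proof.
rewrite (_ : (fun=> c) = fun x => c * \prod_(j : I) (fun=> 1) x); last first.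
  by apply/funext => x; rewrite big1 ?mulr1.
by apply: pol_prod => // j; [exact: all_moments_cst|exact: measurable_cst].
Qed.

Lemma polM A f g : pol A f -> pol A g -> pol A (fun x => f x * g x).
Proof.
move=> pf; elim: pf g => {f} [c f mf af hf|f1 f2 p1 ih1 p2 ih2] g pg; last first.
  rewrite (_ : (fun x => _) = (fun x => f1 x * g x + f2 x * g x)).
    by apply: polD; [exact: ih1|exact: ih2].
  by apply/funext => x; rewrite mulrDl.
elim: pg => {g} [c' g mg ag hg|g1 g2 p1 ih1 p2 ih2].
  rewrite (_ : (fun x => _) = (fun x => (c * c') * \prod_j (f j x * g j x))).
    apply: pol_prod => j.
    - exact: all_momentsM.
    - by apply: measurable_funM; [exact: af|exact: ag].
    - by move=> jA; rewrite hf// hg//; apply/funext => x; rewrite mulr1.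
  by apply/funext => x; rewrite big_split/= mulrACA.
rewrite (_ : (fun x => _) = (fun x => c * \prod_j f j x * g1 x + c * \prod_j f j x * g2 x)).
  exact: polD.
by apply/funext => x; rewrite mulrDr.
Qed.

Lemma polZ A c f : pol A f -> pol A (fun x => c * f x).
Proof. exact/polM/pol_cst. Qed.

Lemma polB A f g : pol A f -> pol A g -> pol A (fun x => f x - g x).
Proof.
move=> pf pg; rewrite (_ : (fun x => _) = (fun x => f x + (-1) * g x)).
  exact/polD/polZ.
by apply/funext => x; rewrite mulN1r.
Qed.

Lemma pol_sum A J (r : seq J) (Q : pred J) (f : J -> T -> R) :
  (forall i, Q i -> pol A (f i)) -> pol A (fun x => \sum_(i <- r | Q i) f i x).
Proof.
move=> pf; elim: r => [|i r ih].
  by rewrite (funext (fun x => big_nil _ _ _ _)); exact: pol_cst.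
rewrite (funext (fun x => big_cons _ _ _ _ _ _)).
by case: (boolP (Q i)) => // Qi; apply: polD => //; exact: pf.
Qed.

Lemma pol_bigprod A J (r : seq J) (Q : pred J) (f : J -> T -> R) :
  (forall i, Q i -> pol A (f i)) -> pol A (fun x => \prod_(i <- r | Q i) f i x).
Proof.
move=> pf; elim: r => [|i r ih].
  by rewrite (funext (fun x => big_nil _ _ _ _)); exact: pol_cst.
rewrite (funext (fun x => big_cons _ _ _ _ _ _)).
by case: (boolP (Q i)) => // Qi; apply: polM => //; exact: pf.
Qed.

Lemma polX A f p : pol A f -> pol A (fun x => f x ^+ p).
Proof.
move=> pf; rewrite (_ : (fun x => _) = (fun x => \prod_(i < p) f x)).
  exact: pol_bigprod.
by apply/funext => x; rewrite prodr_const card_ord.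
Qed.

(** Bilinearity reduces the claim to two products of adapted factors. As [A] and [B] are disjoint,
    at each index at least one of the two factors is the constant 1, so the merged product is again
    one function per component. *)
Lemma Ex_indep A B f g : pol A f -> pol B g ->
  (forall j, j \in A -> j \notin B) ->
  Ex P (fun x => f x * g x) = Ex P f * Ex P g.
Proof.
move=> pf pg AB; elim: pf => {f} [c f mf af hf|f1 f2 p1 ih1 p2 ih2]; last first.
  rewrite (ExD (pol_all_moments p1) (pol_all_moments p2)) mulrDl -ih1 -ih2 -ExD.
  - by congr Ex; apply/funext => x; rewrite mulrDl.
  - exact: all_momentsM (pol_all_moments p1) (pol_all_moments pg).
  - exact: all_momentsM (pol_all_moments p2) (pol_all_moments pg).
have mF : all_moments P (fun x => c * \prod_j f j x).
  exact/all_momentsZ/all_moments_prod.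
elim: pg => {g} [c' g mg ag hg|g1 g2 p1 ih1 p2 ih2]; last first.
  rewrite (ExD (pol_all_moments p1) (pol_all_moments p2)) mulrDr -ih1 -ih2 -ExD.
  - by congr Ex; apply/funext => x; rewrite mulrDr.
  - exact: all_momentsM (pol_all_moments p1).
  - exact: all_momentsM (pol_all_moments p2).
rewrite !ExZ; [|exact: all_moments_prod..].
rewrite !Ex_prod_indep// mulrACA -big_split/=.
transitivity (Ex P (fun x => (c * c') * \prod_j (f j x * g j x))).
  by congr Ex; apply/funext => x; rewrite big_split/= mulrACA.
rewrite ExZ; last by apply: all_moments_prod => j _; exact: all_momentsM.
congr (_ * _).
rewrite (@Ex_prod_indep (fun j x => f j x * g j x)).
- apply: eq_bigr => j _; have [jA|jA] := boolP (j \in A).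
    by rewrite (hg j (AB j jA)) Ex_cst mulr1; congr Ex; apply/funext => x; rewrite mulr1.
  by rewrite hf// Ex_cst mul1r; congr Ex; apply/funext => x; rewrite mul1r.
- by move=> j; exact: all_momentsM.
- by move=> j; apply: measurable_funM; [exact: af|exact: ag].
Qed.

End Independence.

(** * Moments of the normal distribution *)

Section NormalMoments.
Context {R : realType} {dT : measure_display} {T : measurableType dT}.
Variables (P : probability T R) (V : T -> R) (m s : R).
Hypotheses (mV : measurable_fun setT V) (s0 : 0 < s).
Hypothesis lawV : forall B, measurable B -> P (V @^-1` B) = normal_prob m s B.

Let Y x := (V x - m) / s.

Let mY : measurable_fun setT Y.
Proof. by apply: measurable_funM => //; apply: measurable_funB. Qed.

Lemma integral_normal_law (g : R -> R) : measurable_fun setT g -> (forall y, 0 <= g y) ->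
  (\int[P]_x (g (V x))%:E = \int[lebesgue_measure]_y (g y * normal_pdf m s y)%:E)%E.
Proof.
move=> mg g0.
pose X : {RV P >-> R} := mfun_Sub (mem_set mV).
pose nu : {measure set R -> \bar R} := distribution P X.
have mid : measurable_fun (setT : set (measurableTypeR R)) (id : measurableTypeR R -> R).
  by move=> _ B mB; rewrite setTI preimage_id.
transitivity (\int[nu]_y (g y)%:E)%E.
  by rewrite ge0_integral_distribution//; exact/measurable_EFinP.
have nuE B : measurable B -> nu B =
    (\int[lebesgue_measure]_(y in (id : measurableTypeR R -> R) @^-1` B) (normal_pdf m s y)%:E)%E.
  by move=> mB; rewrite preimage_id; exact: lawV.
have mg' : measurable_fun setT (EFin \o g) by exact/measurable_EFinP.
rewrite (ge0_integral_density mid (measurable_normal_pdf m s) (normal_pdf_ge0 m s) nuE mg').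
  by apply: eq_integral => y _; rewrite EFinM.
by move=> y; rewrite lee_fin.
Qed.

Lemma normal_peakM t : 0 < t -> normal_peak (t * s) = t^-1 * normal_peak s.
Proof.
move=> t0; rewrite /normal_peak exprMn -mulrA -mulrnAr sqrtrM ?sqr_ge0// sqrtr_sqr.
by rewrite gtr0_norm// invfM.
Qed.

(** Completing the square, this factor turns the density with mean [m] into the one with mean
    [m + h * s], whose integral is 1. *)
Lemma integral_expR_tilt h : (\int[P]_x (expR (h * Y x - h ^+ 2 / 2))%:E = 1)%E.
Proof.
rewrite -(integral_normal_pdf (m + h * s) s).
rewrite (@integral_normal_law (fun y => expR (h * ((y - m) / s) - h ^+ 2 / 2))).
- apply: eq_integral => y _; congr EFin.
  rewrite !normal_pdfE ?gt_eqF// /normal_fun mulrCA -expRD; congr (_ * expR _).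
  by field; rewrite gt_eqF.
- apply: measurableT_comp => //; apply: measurable_funB => //.
  by do 2 apply: measurable_funM => //; apply: measurable_funB.
- by move=> y; exact: expR_ge0.
Qed.

(** The integrand is the ratio of the normal densities with standard deviations [t * s] and [s]. *)
Lemma integral_expR_scale t : 0 < t ->
  (\int[P]_x (t^-1 * expR ((1 - t ^- 2) * (Y x ^+ 2 / 2)))%:E = 1)%E.
Proof.
move=> t0; have ts0 : 0 < t * s by rewrite mulr_gt0.
rewrite -(integral_normal_pdf m (t * s)).
rewrite (@integral_normal_law (fun y => t^-1 * expR ((1 - t ^- 2) * (((y - m) / s) ^+ 2 / 2)))).
- apply: eq_integral => y _; congr EFin.
  rewrite !normal_pdfE ?gt_eqF// normal_peakM// /normal_fun mulrACA -expRD; congr (_ * expR _).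
  by field; rewrite !gt_eqF.
- apply: measurable_funM => //; apply: measurableT_comp => //.
  apply: measurable_funM => //; apply: measurable_funM => //.
  apply: measurable_funX => //.
  by apply: measurable_funM => //; apply: measurable_funB.
- by move=> y; rewrite mulr_ge0 ?expR_ge0// invr_ge0 ltW.
Qed.

(** For [q > 0], write [z = (z / q) * q] and raise [z / q <= expR (z / q)] to the power [q]. *)
Lemma exprn_le_expR (z : R) q : 0 <= z -> z ^+ q <= q%:R ^+ q * expR z.
Proof.
move=> z0; case: q => [|q]; first by rewrite !expr0 mul1r -[leLHS]expR0 ler_expR.
have q0 : 0 < q.+1%:R :> R by rewrite ltr0n.
rewrite -[in expR z](divfK (lt0r_neq0 q0) z) expRM_natr -exprMn.
rewrite lerXn2r// ?nnegrE ?mulr_ge0 ?expR_ge0 ?(ltW q0)//.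
rewrite -ler_pdivrMl// mulrC; apply: le_trans (expR_ge1Dx _).
by rewrite lerDr.
Qed.

(* [Y ^+ (q * 2)] is dominated by a multiple of [expR (3 / 8 * Y ^+ 2)], which is
   twice the ratio of the densities with standard deviations [2 * s] and [s]. *)
Lemma normal_moment_bound q :
  (\int[P]_x (Y x ^+ (q * 2))%:E <= (2 * (8 / 3 * q%:R) ^+ q)%:E)%E.
Proof.
have t2 : 0 < 2 :> R by [].
have h : (\int[P]_x (expR (3 / 8 * Y x ^+ 2))%:E = 2%:E)%E.
  transitivity (2%:E * \int[P]_x (2^-1 * expR ((1 - 2 ^- 2) * (Y x ^+ 2 / 2)))%:E)%E.
    rewrite -ge0_integralZl//.
    - apply: eq_integral => x _; rewrite -EFinM [in RHS]mulrA divff// mul1r.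
      by congr (expR _)%:E; field.
    - apply/measurable_EFinP/measurable_funM => //; apply: measurableT_comp => //.
      by apply: measurable_funM => //; apply: measurable_funM => //; apply: measurable_funX.
  by rewrite integral_expR_scale// mule1.
rewrite mulrC EFinM -h -ge0_integralZl ?lee_fin ?exprn_ge0 ?mulr_ge0//; last first.
  by apply/measurable_EFinP; apply: measurableT_comp => //; apply: measurable_funM => //; apply: measurable_funX.
apply: ge0_le_integral => //.
- by move=> x _; rewrite lee_fin mulnC exprM exprn_ge0// sqr_ge0.
- exact/measurable_EFinP/measurable_funX.
- apply/measurable_EFinP/measurable_funM => //.
  by apply: measurableT_comp => //; apply: measurable_funM => //; apply: measurable_funX.
move=> x _; rewrite -EFinM lee_fin mulnC exprM.
move: (sqr_ge0 (Y x)); move: (Y x ^+ 2) => y y0.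
rewrite exprMn -[leRHS]mulrA.
have z0 : 0 <= 3 / 8 * y by rewrite mulr_ge0.
apply: (@le_trans _ _ ((8 / 3) ^+ q * (3 / 8 * y) ^+ q)).
  by rewrite -exprMn mulrA (_ : 8 / 3 * (3 / 8) = 1) ?mul1r//; field.
by rewrite ler_wpM2l ?exprn_ge0//; exact: exprn_le_expR.
Qed.

Lemma normal_all_moments : all_moments P Y.
Proof.
split=> // p.
apply: (@le_integrable _ _ _ P _ measurableT _ (fun x => (1 + Y x ^+ (p * 2))%:E)).
- by apply/measurable_EFinP/measurable_funX; apply: measurableT_comp.
- move=> x _ /=; rewrite lee_fin normrX normr_id exprM.
  apply: le_trans (ler_norm _); rewrite -[in leRHS]real_normK ?num_real// normrX.
  by move: (`|Y x| ^+ p) => a; have := sqr_ge0 (a - 1); nra.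
- have mYp : measurable_fun setT (fun x => Y x ^+ (p * 2)) by exact: measurable_funX.
  have Yp0 x : 0 <= Y x ^+ (p * 2) by rewrite mulnC exprM exprn_ge0// sqr_ge0.
  apply/integrableP; split; first by apply/measurable_EFinP; exact: measurable_funD.
  rewrite (eq_integral (fun x => 1%:E + (Y x ^+ (p * 2))%:E)%E); last first.
    by move=> x _; rewrite abse_EFin ger0_norm// addr_ge0.
  rewrite ge0_integralD//; last 2 first.
  - by move=> x _; rewrite lee_fin.
  - exact/measurable_EFinP.
  rewrite integral_cst//= probability_setT mul1e lte_add_pinfty ?ltry//.
  exact: le_lt_trans (normal_moment_bound p) (ltry _).
Qed.

(* Integrating [expR z >= 1 + z] against the tilted density gives
   [h * Ex Y <= h ^+ 2 / 2] for every [h]. *)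
Lemma Ex_normal1 : Ex P Y = 0.
Proof.
have mY' := normal_all_moments.
have key h : h * Ex P Y <= h ^+ 2 / 2.
  pose g x := expR (h * Y x - h ^+ 2 / 2).
  have mg : measurable_fun setT g.
    apply: measurableT_comp => //; apply: measurable_funB => //.
    exact: measurable_funM.
  have ig : P.-integrable setT (EFin \o g).
    apply/integrableP; split; first exact/measurable_EFinP.
    rewrite (eq_integral (fun x => (g x)%:E)); last first.
      by move=> x _ /=; rewrite ger0_norm// expR_ge0.
    by rewrite integral_expR_tilt ltry.
  have m1 : all_moments P (fun x => (1 - h ^+ 2 / 2) + h * Y x).
    by apply: all_momentsD; [exact: all_moments_cst|exact: all_momentsZ].
  have := @le_Rintegral _ _ _ P setT _ g measurableT (all_moments_int m1) ig.
  rewrite -/(Ex P _) ExD; [|exact: all_moments_cst|exact: all_momentsZ].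
  rewrite ExZ// Ex_cst {1}/Rintegral integral_expR_tilt/= => /(_ _)/wrap[].
    by move=> x _; rewrite /g; move: (Y x) => y; apply: le_trans (expR_ge1Dx _); lra.
  by lra.
(* The choice [h = Ex P Y] bounds the square of the mean by half of itself. *)
have := key (Ex P Y); rewrite -expr2 => h.
by apply/eqP; rewrite -sqrf_eq0 eq_le sqr_ge0 andbT; lra.
Qed.

(* Integrating [expR z >= 1 + z] against the density rescaled by [t] bounds
   [(t ^+ 2 - 1) * Ex (Y ^+ 2)] for every [t > 0]; then [t] tends to 1. *)
Lemma Ex_normal2 : Ex P (fun x => Y x ^+ 2) = 1.
Proof.
have mY' := normal_all_moments.
have mY2 := all_momentsX 2 mY'.
set M := Ex P _.
have M0 : 0 <= M by apply: Ex_ge0 => x; exact: sqr_ge0.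
have key t : 0 < t -> (t ^+ 2 - 1) * M <= 2 * t ^+ 2 * (t - 1).
  move=> t0; pose g x := t^-1 * expR ((1 - t ^- 2) * (Y x ^+ 2 / 2)).
  have mg : measurable_fun setT g.
    apply: measurable_funM => //; apply: measurableT_comp => //.
    by apply: measurable_funM => //; apply: measurable_funM => //; apply: measurable_funX.
  have ig : P.-integrable setT (EFin \o g).
    apply/integrableP; split; first exact/measurable_EFinP.
    rewrite (eq_integral (fun x => (g x)%:E)); last first.
      by move=> x _ /=; rewrite ger0_norm// mulr_ge0 ?expR_ge0// invr_ge0 ltW.
    by rewrite integral_expR_scale// ltry.
  have m1 : all_moments P (fun x => t^-1 + (t^-1 * ((1 - t ^- 2) / 2)) * Y x ^+ 2).
    by apply: all_momentsD; [exact: all_moments_cst|exact: all_momentsZ].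
  have := @le_Rintegral _ _ _ P setT _ g measurableT (all_moments_int m1) ig.
  rewrite -/(Ex P _) ExD; [|exact: all_moments_cst|exact: all_momentsZ].
  rewrite ExZ// Ex_cst {1}/Rintegral integral_expR_scale//= -/M => /(_ _)/wrap[].
    move=> x _; rewrite /g; move: (Y x) => y.
    rewrite -mulrA -[X in X + _]mulr1 -mulrDr ler_pM2l ?invr_gt0//.
    by apply: le_trans (expR_ge1Dx _); move: (t ^- 2) (y ^+ 2) => u v; lra.
  move=> le1.
  have t3 : 0 < 2 * t ^+ 3 by rewrite mulr_gt0// exprn_gt0.
  have := ler_wpM2l (ltW t3) le1.
  rewrite (_ : 2 * t ^+ 3 * (t^-1 + t^-1 * ((1 - t ^- 2) / 2) * M) =
    2 * t ^+ 2 + (t ^+ 2 - 1) * M); last by field; rewrite gt_eqF.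
  by lra.
apply/eqP; rewrite eq_le; apply/andP; split; rewrite leNgt; apply/negP => h.
  (* At [t = 1 + e], division by [e] leaves [(2 + e) * M <= 2 * (1 + e) ^+ 2], which fails for this
     [e] since [M = (1 + 2 * e) / (1 - e)]. The case [M < 1] is refuted likewise at [t = 1 - e]. *)
  pose e := (M - 1) / (M + 2).
  have e0 : 0 < e by rewrite divr_gt0//; lra.
  have eM : e * (M + 2) = M - 1 by rewrite divfK// gt_eqF//; lra.
  have := key (1 + e); rewrite addr_gt0// => /(_ isT).
  rewrite (_ : (1 + e) ^+ 2 - 1 = e * (2 + e)); last by ring.
  rewrite (_ : 2 * _ * (1 + e - 1) = e * (2 * (1 + e) ^+ 2)); last by ring.
  by rewrite -mulrA ler_pM2l//; nra.
pose e := (1 - M) / 4.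
have e0 : 0 < e by rewrite divr_gt0//; lra.
have eM : 4 * e = 1 - M by rewrite /e; field.
have := key (1 - e); rewrite subr_gt0 => /(_ _)/wrap[]; first by lra.
rewrite (_ : (1 - e) ^+ 2 - 1 = - (e * (2 - e))); last by ring.
rewrite (_ : 2 * _ * (1 - e - 1) = - (e * (2 * (1 - e) ^+ 2))); last by ring.
by rewrite mulNr lerN2 -[leRHS]mulrA ler_pM2l//; nra.
Qed.

Lemma Ex_normal6 : Ex P (fun x => Y x ^+ 6) <= 1024.
Proof.
rewrite -lee_fin -EFin_Ex; last exact/all_momentsX/normal_all_moments.
(* For [q = 3] the bound is [2 * 8 ^ 3 = 1024]. *)
apply: le_trans (normal_moment_bound 3) _.
by rewrite lee_fin; lra.
Qed.

End NormalMoments.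

(** * Traces, Cholesky factorisation and Kronecker products *)

Section MatrixFacts.
Context {R : realType}.

(** Lagrange's identity: the difference of the two sides is half the double sum of the squares of
    [a i * b j - a j * b i]. *)
Lemma cauchy_schwarz_sum (I : finType) (a b : I -> R) :
  (\sum_i a i * b i) ^+ 2 <= (\sum_i a i ^+ 2) * (\sum_i b i ^+ 2).
Proof.
have : 0 <= \sum_i \sum_j (a i * b j - a j * b i) ^+ 2.
  by apply: sumr_ge0 => i _; apply: sumr_ge0 => j _; exact: sqr_ge0.
suff -> : \sum_i \sum_j (a i * b j - a j * b i) ^+ 2 =
    2 * ((\sum_i a i ^+ 2) * (\sum_i b i ^+ 2) - (\sum_i a i * b i) ^+ 2).
  by rewrite pmulr_rge0// subr_ge0.
have e1 : \sum_i \sum_j (a i ^+ 2 * b j ^+ 2) = (\sum_i a i ^+ 2) * (\sum_i b i ^+ 2).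
  by rewrite mulr_suml; apply: eq_bigr => i _; rewrite mulr_sumr.
have e2 : \sum_i \sum_j (a j ^+ 2 * b i ^+ 2) = (\sum_i a i ^+ 2) * (\sum_i b i ^+ 2).
  by rewrite exchange_big.
have e3 : \sum_i \sum_j (a i * b i * (a j * b j)) = (\sum_i a i * b i) ^+ 2.
  by rewrite expr2 mulr_suml; apply: eq_bigr => i _; rewrite mulr_sumr.
rewrite mulrBr mulr_natl mulr2n -{1}e1 -e2 -e3 -big_split/= mulr_sumr -sumrB.
apply: eq_bigr => i _; rewrite -big_split/= mulr_sumr -sumrB.
by apply: eq_bigr => j _; ring.
Qed.

Definition frob2 m n (A : 'M[R]_(m, n)) : R := \sum_i \sum_j A i j ^+ 2.

Lemma frob2_ge0 m n (A : 'M[R]_(m, n)) : 0 <= frob2 A.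
Proof. by apply: sumr_ge0 => i _; apply: sumr_ge0 => j _; exact: sqr_ge0. Qed.

Lemma frob2_eq0 m n (A : 'M[R]_(m, n)) : frob2 A = 0 -> A = 0.
Proof.
move/eqP; rewrite psumr_eq0 => [/allP h|i _]; last first.
  by apply: sumr_ge0 => j _; exact: sqr_ge0.
apply/matrixP => i j; rewrite mxE.
have := h i (mem_index_enum _); rewrite psumr_eq0 => [/allP h'|k _]; last exact: sqr_ge0.
by have := h' j (mem_index_enum _); rewrite /= sqrf_eq0 => /eqP.
Qed.

Lemma mxtrace_mulT m n (A B : 'M[R]_(m, n)) : \tr (A *m B^T) = \sum_i \sum_j A i j * B i j.
Proof.
by apply: eq_bigr => i _; rewrite mxE; apply: eq_bigr => j _; rewrite mxE.
Qed.

Lemma frob2_tr m n (A : 'M[R]_(m, n)) : frob2 A = \tr (A *m A^T).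
Proof.
by rewrite mxtrace_mulT; apply: eq_bigr => i _; apply: eq_bigr => j _; rewrite expr2.
Qed.

Lemma tr_mulT_sqr_le m n (A B : 'M[R]_(m, n)) : \tr (A *m B^T) ^+ 2 <= frob2 A * frob2 B.
Proof.
rewrite mxtrace_mulT /frob2 !pair_bigA.
exact: (cauchy_schwarz_sum (fun p => A p.1 p.2) (fun p => B p.1 p.2)).
Qed.

Lemma frob2_mul m n p (A : 'M[R]_(m, n)) (B : 'M[R]_(n, p)) :
  frob2 (A *m B) <= frob2 A * frob2 B.
Proof.
rewrite [X in _ * X](_ : frob2 B = \sum_j \sum_k B k j ^+ 2); last exact: exchange_big.
rewrite mulr_suml; apply: ler_sum => i _; rewrite mulr_sumr; apply: ler_sum => j _.
by rewrite mxE; exact: cauchy_schwarz_sum.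
Qed.

(** Cauchy-Schwarz for the trace form applied to [M ^ 2] and [M], then submultiplicativity of the
    Frobenius norm. It serves both for [t3 ^ 2 <= t2 ^ 3] and for the bound on [1 / eta_Na]. *)
Lemma tr3_sqr_le n (M : 'M[R]_n) : M^T = M ->
  \tr (M *m M *m M) ^+ 2 <= \tr (M *m M) ^+ 3.
Proof.
move=> sM; have f2 : \tr (M *m M) = frob2 M by rewrite frob2_tr sM.
rewrite f2 -[X in _ *m X]sM.
apply: le_trans (tr_mulT_sqr_le _ _) _.
by rewrite exprSr ler_wpM2r ?frob2_ge0// expr2 frob2_mul.
Qed.

Lemma dotvE n (u v : 'cV[R]_n) : dotv u v = \sum_k u k 0 * v k 0.
Proof. by rewrite /dotv mxE; apply: eq_bigr => k _; rewrite mxE. Qed.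

(** Block elimination: the Schur complement of the top left entry is again positive definite, and
    its factor fills the lower right block. *)
Lemma posdef_cholesky n (S : 'M[R]_n) : posdef S -> exists L : 'M[R]_n, S = L *m L^T.
Proof.
elim: n S => [|n ih] S [symS pdS]; first by exists 0; rewrite [LHS]flatmx0 [RHS]flatmx0.
pose S1 : 'M[R]_(1 + n) := S.
pose a := S1 0 0.
pose c : 'cV[R]_n := dlsubmx S1.
pose D : 'M[R]_n := drsubmx S1.
have ulE : ulsubmx S1 = a%:M.
  by rewrite [LHS]mx11_scalar !mxE; congr (S1 _ _)%:M; exact: val_inj.
have urE : ursubmx S1 = c^T.
  by rewrite /c -[S1 in RHS](symS : S1^T = S1) trmx_dlsub trmxK.
have DT : D^T = D by rewrite /D trmx_drsub (symS : S1^T = S1).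
have SE : S1 = block_mx a%:M c^T c D by rewrite -ulE -urE submxK.
have a0 : 0 < a.
  have := pdS (delta_mx 0 0); rewrite dotvE (bigD1 0)//= big1 ?addr0; last first.
    by move=> k k0; rewrite !mxE (negbTE k0) mul0r.
  rewrite !mxE eqxx mul1r (bigD1 0)//= big1 ?addr0; last first.
    by move=> k k0; rewrite !mxE (negbTE k0) mulr0.
  rewrite !mxE eqxx mulr1; apply.
  apply/eqP => /matrixP/(_ 0 0); rewrite !mxE !eqxx => /eqP.
  by rewrite oner_eq0.
have ane0 : a != 0 by rewrite gt_eqF.
have [|L SL] := ih (D - a^-1 *: (c *m c^T)).
  split.
    by rewrite linearB/= linearZ/= trmx_mul trmxK DT.
  move=> w w0.
  (* This [x] cancels the first entry of [S *m u], so the form of [S] at [u] equals the form of the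
     Schur complement at [w]. *)
  pose x : 'M[R]_1 := - (a^-1 *: (c^T *m w)).
  pose u : 'cV[R]_(1 + n) := col_mx x w.
  have u0 : u != 0.
    by apply: contra w0 => /eqP u0; rewrite -(col_mxKd x w) -/u u0 linear0.
  have pdS1 : forall v : 'cV[R]_(1 + n), v != 0 -> 0 < dotv v (S1 *m v) by [].
  have := pdS1 u u0.
  rewrite /dotv SE mul_block_col tr_col_mx mul_row_col.
  rewrite mul_scalar_mx {1}/x scalerN scalerA divff// scale1r addNr mulmx0 add0r.
  suff -> : c *m x + D *m w = (D - a^-1 *: (c *m c^T)) *m w by [].
  by rewrite mulmxBl /x mulmxN -scalemxAr -scalemxAl mulmxA addrC.
pose q := Num.sqrt a.
have q0 : q != 0 by rewrite gt_eqF// sqrtr_gt0.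
have qq : q * q = a by rewrite -expr2 sqr_sqrtr// ltW.
exists (block_mx q%:M 0 (q^-1 *: c) L : 'M[R]_(1 + n)).
suff : S1 = block_mx q%:M 0 (q^-1 *: c) L *m (block_mx q%:M 0 (q^-1 *: c) L)^T by [].
rewrite SE tr_block_mx mulmx_block !trmx0 !mulmx0 !mul0mx !addr0 tr_scalar_mx.
congr block_mx.
- by rewrite mul_scalar_mx scale_scalar_mx qq.
- by rewrite mul_scalar_mx linearZ/= scalerA divff// scale1r.
- by rewrite mul_mx_scalar scalerA divff// scale1r.
- by rewrite -SL linearZ/= -scalemxAl -scalemxAr scalerA -invfM qq addrC subrK.
Qed.

Lemma kron_reindex m n (F : 'I_m * 'I_n -> R) :
  \sum_(k < m * n) F (enum_val (cast_ord (esym (mxvec_cast m n)) k)) = \sum_p F p.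
Proof.
rewrite [RHS](reindex (fun k => enum_val (cast_ord (esym (mxvec_cast m n)) k)))//=.
apply: onW_bij; apply: (bij_comp (enum_val_bij _)).
exact: (Bijective (cast_ordK _) (cast_ordKV _)).
Qed.

Lemma kronmx_mul m n p q r s (A : 'M[R]_(m, p)) (B : 'M[R]_(n, q))
    (C : 'M[R]_(p, r)) (D : 'M[R]_(q, s)) :
  kronmx A B *m kronmx C D = kronmx (A *m C) (B *m D).
Proof.
apply/matrixP => k l; rewrite !mxE.
set i := enum_val _; set j := enum_val _.
transitivity (\sum_(z : 'I_p * 'I_q) (A i.1 z.1 * B i.2 z.2) * (C z.1 j.1 * D z.2 j.2)).
  by rewrite -kron_reindex; apply: eq_bigr => z _; rewrite !mxE.
rewrite mulr_suml -(pair_bigA _ (fun z1 z2 => A i.1 z1 * B i.2 z2 * (C z1 j.1 * D z2 j.2)))/=.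
apply: eq_bigr => z1 _; rewrite mulr_sumr; apply: eq_bigr => z2 _.
by rewrite mulrACA.
Qed.

Lemma mxtrace_kronmx m n (A : 'M[R]_m) (B : 'M[R]_n) : \tr (kronmx A B) = \tr A * \tr B.
Proof.
transitivity (\sum_(z : 'I_m * 'I_n) A z.1 z.1 * B z.2 z.2).
  by rewrite -kron_reindex; apply: eq_bigr => z _; rewrite !mxE.
rewrite /mxtrace mulr_suml -(pair_bigA _ (fun z1 z2 => A z1 z1 * B z2 z2))/=.
by apply: eq_bigr => z1 _; rewrite mulr_sumr.
Qed.

(** [D *m TW] is not symmetric, but with [H] the square root of [D] the symmetric matrix
    [H *m TW *m H] has the same traces of powers, and [tr3_sqr_le] applies to it. *)
Lemma eta_Na_inv_bounds a (n : 'I_a -> nat) (TW : 'M[R]_a) : TW^T = TW ->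
  0 <= (eta_Na n TW)^-1 <= 1.
Proof.
move=> sT; rewrite /eta_Na.
pose D := Dmat n : 'M[R]_a.
pose H : 'M[R]_a := diag_mx (\row_i Num.sqrt ((Ntot n)%:R / (n i)%:R)).
have HH : H *m H = D.
  rewrite /H /D /Dmat mulmx_diag; congr diag_mx; apply/rowP => i; rewrite !mxE.
  by rewrite -expr2 sqr_sqrtr// divr_ge0.
pose M := H *m TW *m H.
have sM : M^T = M by rewrite /M !trmx_mul sT tr_diag_mx mulmxA.
have e2 : \tr (D *m TW *m (D *m TW)) = \tr (M *m M).
  by rewrite -HH /M !mulmxA [RHS]mxtrace_mulC !mulmxA.
have e3 : \tr (D *m TW *m (D *m TW) *m (D *m TW)) = \tr (M *m M *m M).
  by rewrite -HH /M !mulmxA [RHS]mxtrace_mulC !mulmxA.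
rewrite -/D e2 e3 invfM invrK.
have t0 : 0 <= \tr (M *m M) by rewrite -[X in _ *m X]sM -frob2_tr frob2_ge0.
have t30 : 0 <= \tr (M *m M) ^+ 3 by rewrite exprn_ge0.
rewrite mulrC divr_ge0 ?sqr_ge0//=.
(* A vanishing denominator is harmless: the quotient is then 0 by convention. *)
have [->|ne] := eqVneq (\tr (M *m M) ^+ 3) 0; first by rewrite invr0 mulr0.
by rewrite ler_pdivrMr ?mul1r ?tr3_sqr_le// lt_def ne.
Qed.

(** * Covariance of the projected observations *)

Section Projected.
Variables (d : nat) (TS Sig : 'M[R]_d).
Hypotheses (hT : sym_idem_nz TS) (hS : posdef Sig).

(** The covariance matrix of [TS *m X_ij]. By cyclicity of the trace and idempotence of [TS] its
    square and cube have the traces of those of [TS *m Sig], and it is symmetric. *)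
Definition projcov : 'M[R]_d := TS *m Sig *m TS.

Lemma projcov_sym : projcov^T = projcov.
Proof.
have [sT _ _] := hT; have [sS _] := hS.
by rewrite /projcov !trmx_mul sT sS mulmxA.
Qed.

Lemma tr_projcov2 : \tr ((TS *m Sig) *m (TS *m Sig)) = \tr (projcov *m projcov).
Proof.
have [_ iT _] := hT.
rewrite /projcov !mulmxA [RHS]mxtrace_mulC !mulmxA iT.
by rewrite -[in RHS](mulmxA _ TS TS) iT.
Qed.

Lemma tr_projcov3 : \tr ((TS *m Sig) *m (TS *m Sig) *m (TS *m Sig)) =
  \tr (projcov *m projcov *m projcov).
Proof.
have [_ iT _] := hT.
rewrite /projcov !mulmxA [RHS]mxtrace_mulC !mulmxA iT.
by rewrite -!(mulmxA _ TS TS) iT.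
Qed.

Lemma projcov_form (v : 'cV[R]_d) :
  dotv v (projcov *m v) = dotv (TS *m v) (Sig *m (TS *m v)).
Proof. by have [sT _ _] := hT; rewrite /dotv /projcov trmx_mul sT !mulmxA. Qed.

(** [projcov] is only semidefinite in general. Its null directions are killed by [TS] because [Sig]
    is definite, so a degenerate linear form of the projected data vanishes identically and not just
    almost surely. *)
Lemma projcov_form_eq0 v : dotv v (projcov *m v) = 0 -> TS *m v = 0.
Proof.
rewrite projcov_form => h; apply/eqP/negPn/negP => ne.
by have [_ /(_ _ ne)] := hS; rewrite h ltxx.
Qed.

Lemma tr_projcov2_gt0 : 0 < \tr (projcov *m projcov).
Proof.
rewrite -[X in _ *m X]projcov_sym -frob2_tr lt_def frob2_ge0 andbT.
apply/eqP => /frob2_eq0 M0; have [_ _ /eqP] := hT; apply.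
apply/matrixP => i j; rewrite mxE.
have /matrixP/(_ i 0) : TS *m delta_mx j 0 = 0 :> 'cV_d.
  by apply: projcov_form_eq0; rewrite M0 mul0mx /dotv mulmx0 mxE.
rewrite !mxE (bigD1 j)//= big1 ?addr0 => [|k kj].
  by rewrite mxE !eqxx mulr1.
by rewrite mxE (negbTE kj) mulr0.
Qed.

Lemma projcov_cholesky : exists L : 'M[R]_d, projcov = L *m L^T.
Proof.
have [L SE] := posdef_cholesky hS; have [sT _ _] := hT.
by exists (TS *m L); rewrite trmx_mul sT !mulmxA /projcov SE !mulmxA.
Qed.

(** Traces of Kronecker products factor, which isolates the same known factor [(eta_Na n TW)^-1]
    that multiplies the estimated ratio. *)
Lemma fP_inv a (n : 'I_a -> nat) (TW : 'M[R]_a) :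
  (fP n TW TS Sig)^-1 = (eta_Na n TW)^-1 *
    (\tr (projcov *m projcov *m projcov) ^+ 2 / \tr (projcov *m projcov) ^+ 3).
Proof.
rewrite /fP /eta_Na !kronmx_mul !mxtrace_kronmx tr_projcov2 tr_projcov3.
rewrite (_ : \tr (TW *m Dmat n *m (TW *m Dmat n)) = \tr (Dmat n *m TW *m (Dmat n *m TW))); last first.
  by rewrite !mulmxA mxtrace_mulC !mulmxA.
rewrite (_ : \tr (TW *m Dmat n *m (TW *m Dmat n) *m (TW *m Dmat n)) =
   \tr (Dmat n *m TW *m (Dmat n *m TW) *m (Dmat n *m TW))); last first.
  by rewrite !mulmxA mxtrace_mulC !mulmxA.
by rewrite !exprMn !invfM !invrK mulrACA [X in _ * X = _]mulrC [X in X * _]mulrC.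
Qed.

End Projected.
End MatrixFacts.

(** * Moments of the kernels *)

Section RealInequalities.
Context {R : realType}.
Implicit Types x y z : R.

Lemma amgm3 x y z : 0 <= x -> 0 <= y -> 0 <= z -> x * y * z <= (x ^+ 3 + y ^+ 3 + z ^+ 3) / 3.
Proof.
move=> x0 y0 z0; rewrite -subr_ge0.
rewrite (_ : _ - _ = (x + y + z) * ((x - y) ^+ 2 + (y - z) ^+ 2 + (z - x) ^+ 2) / 6); last by field.
by rewrite divr_ge0// mulr_ge0// ?addr_ge0// ?sqr_ge0.
Qed.

(** Convexity in two stages, for squares with constant 2 and for cubes with constant 4, gives
    [2 ^ 3 * 4 = 32]. *)
Lemma exprD6_le x y : (x + y) ^+ 6 <= 32 * (x ^+ 6 + y ^+ 6).
Proof.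
rewrite !(exprM _ 2 3).
apply: (@le_trans _ _ ((2 * (x ^+ 2 + y ^+ 2)) ^+ 3)).
  rewrite lerXn2r ?nnegrE ?sqr_ge0 ?mulr_ge0 ?addr_ge0 ?sqr_ge0//.
  by have := sqr_ge0 (x - y); nra.
move: (sqr_ge0 x) (sqr_ge0 y); move: (x ^+ 2) (y ^+ 2) => u v u0 v0.
rewrite -subr_ge0 (_ : _ - _ = 24 * ((u + v) * (u - v) ^+ 2)); last by ring.
by rewrite mulr_ge0// mulr_ge0 ?sqr_ge0// addr_ge0.
Qed.

Lemma exprD6_le4 x y z (w : R) :
  (x - y - z + w) ^+ 6 <= 1024 * (x ^+ 6 + y ^+ 6 + z ^+ 6 + w ^+ 6).
Proof.
have e (u : R) : (- u) ^+ 6 = u ^+ 6 by ring.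
rewrite (_ : x - y - z + w = (x - y) + (w - z)); last by ring.
apply: le_trans (exprD6_le _ _) _.
have h1 := exprD6_le x (- y); have h2 := exprD6_le w (- z).
by rewrite e in h1; rewrite e in h2; lra.
Qed.

(** Interpolation between second and sixth powers; the free parameter [c] later restores homogeneity
    in [t2]. *)
Lemma expr4_le x c : 0 < c -> x ^+ 4 <= c * x ^+ 2 + x ^+ 6 / c.
Proof.
move=> c0; have -> : x ^+ 6 / c = c * (x ^+ 3 / c) ^+ 2 by field; rewrite gt_eqF.
have e : x ^+ 4 = c * (x * (x ^+ 3 / c)) by field; rewrite gt_eqF.
rewrite e -mulrDr ler_pM2l//.
by move: (x ^+ 3 / c) => y; have := sqr_ge0 (x - y); have := sqr_ge0 (x + y); nra.
Qed.

Lemma expr_sum (I : finType) k (F : I -> R) :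
  (\sum_p F p) ^+ k = \sum_(f : {ffun 'I_k -> I}) \prod_i F (f i).
Proof.
transitivity (\prod_(i < k) \sum_p F p); first by rewrite prodr_const card_ord.
exact: (bigA_distr_bigA (fun _ p => F p)).
Qed.

End RealInequalities.

Section Sample.
Context {R : realType} {dT : measure_display} {T : measurableType dT}.
Variable P : probability T R.
Variables (I : finType) (G : I -> set (set T)).
Hypothesis sub_meas : forall j A, <<s G j >> A -> measurable A.
Hypothesis indepG : forall A : I -> set T, (forall j, <<s G j >> (A j)) ->
  P (\bigcap_j A j) = (\prod_(j : I) P (A j))%E.

(* A form of Fubini's theorem: both sides expand into the same monomials. *)
Lemma Ex_fubini_expr (J : finType) k A B (a b : J -> T -> R) :
  (forall p, pol P G A (a p)) -> (forall p, pol P G B (b p)) ->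
  (forall j, j \in A -> j \notin B) ->
  all_moments P (fun t => Ex P (fun s => (\sum_p a p s * b p t) ^+ k)) /\
  Ex P (fun x => (\sum_p a p x * b p x) ^+ k) =
  Ex P (fun t => Ex P (fun s => (\sum_p a p s * b p t) ^+ k)).
Proof.
move=> pa pb AB.
have pA (f : {ffun 'I_k -> J}) : pol P G A (fun s => \prod_i a (f i) s).
  exact: pol_bigprod.
have pB (f : {ffun 'I_k -> J}) : pol P G B (fun s => \prod_i b (f i) s).
  exact: pol_bigprod.
have mA f := pol_all_moments (pA f); have mB f := pol_all_moments (pB f).
have inner t : Ex P (fun s => (\sum_p a p s * b p t) ^+ k) =
    \sum_(f : {ffun 'I_k -> J}) Ex P (fun s => \prod_i a (f i) s) * \prod_i b (f i) t.
  transitivity (Ex P (fun s => \sum_(f : {ffun 'I_k -> J})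
      (\prod_i b (f i) t) * \prod_i a (f i) s)).
    congr Ex; apply/funext => s; rewrite expr_sum; apply: eq_bigr => f _.
    by rewrite big_split mulrC.
  rewrite Ex_sum => [|f _]; last exact: all_momentsZ.
  by apply: eq_bigr => f _; rewrite ExZ// mulrC.
rewrite (funext inner); split.
  by apply: all_moments_sum => f _; exact: all_momentsZ.
rewrite Ex_sum => [|f _]; last exact: all_momentsZ.
transitivity (Ex P (fun x => \sum_(f : {ffun 'I_k -> J})
    (\prod_i a (f i) x) * \prod_i b (f i) x)).
  congr Ex; apply/funext => s; rewrite expr_sum; apply: eq_bigr => f _.
  by rewrite big_split.
rewrite Ex_sum => [|f _]; last exact: all_momentsM.
by apply: eq_bigr => f _; rewrite (Ex_indep sub_meas indepG (pA f) (pB f) AB) ExZ.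
Qed.

(** In essence Minkowski's inequality in L^3 for the variables [y k ^+ 2], proved by expanding the
    cube and bounding each term by a weighted arithmetic-geometric mean. Terms of zero weight cannot
    be normalised, hence the assumption that they vanish. *)
Lemma Ex_cube_sum_sqr_le (J : finType) (y : J -> T -> R) (c : J -> R) K :
  0 <= K -> (forall k, all_moments P (y k)) -> (forall k, 0 <= c k) ->
  (forall k, c k = 0 -> forall x, y k x = 0) ->
  (forall k, Ex P (fun x => y k x ^+ 6) <= K * c k ^+ 3) ->
  Ex P (fun x => (\sum_k y k x ^+ 2) ^+ 3) <= K * (\sum_k c k) ^+ 3.
Proof.
move=> K0 my c0 yc y6.
have my2 k := all_momentsX 2 (my k); have my6 k := all_momentsX 6 (my k).
under [X in Ex P X]eq_fun do rewrite expr_sum.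
rewrite Ex_sum => [|f _]; last exact: all_moments_prod.
rewrite expr_sum mulr_sumr; apply: ler_sum => f _.
have prod3 (F : 'I_3 -> R) : \prod_i F i = F ord0 * F (inord 1) * F (inord 2).
  rewrite !big_ord_recl big_ord0 mulr1 mulrA; congr (_ * F _ * F _);
  by apply: val_inj; rewrite /= inordK.
have [/existsP[i /eqP ci0]|] := boolP [exists i, c (f i) == 0].
  rewrite [X in Ex P X](_ : _ = fun=> 0).
    by rewrite Ex_cst mulr_ge0// prodr_ge0.
  by apply/funext => x; rewrite (bigD1 i)//= (yc _ ci0) expr0n mul0r.
rewrite negb_exists => /forallP cne.
have cp i : 0 < c (f i) by rewrite lt_def cne c0.
rewrite [X in _ <= _ * X]prod3.
move: (cp ord0) (cp (inord 1)) (cp (inord 2)).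
set i0 := f ord0; set i1 := f (inord 1); set i2 := f (inord 2) => p0 p1 p2.
pose C := c i0 * c i1 * c i2.
have Cp : 0 < C by rewrite !mulr_gt0.
(* The inequality is applied to the normalised variables [y i x ^+ 2 / c i], after factoring out
   [C]. *)
pose z i x := (C / 3 / c i ^+ 3) * y i x ^+ 6.
have mz i : all_moments P (z i) by exact: all_momentsZ.
apply: (@le_trans _ _ (Ex P (fun x => z i0 x + z i1 x + z i2 x))).
  apply: Ex_le.
  - exact: all_moments_prod.
  - by apply: all_momentsD => //; exact: all_momentsD.
  move=> x; rewrite prod3 -/i0 -/i1 -/i2 /z.
  have r0 i : 0 < c i -> 0 <= y i x ^+ 2 / c i.
    by move=> ci; rewrite divr_ge0 ?sqr_ge0// ltW.
  have := ler_wpM2l (ltW Cp) (amgm3 (r0 _ p0) (r0 _ p1) (r0 _ p2)).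
  rewrite [leLHS](_ : _ = y i0 x ^+ 2 * y i1 x ^+ 2 * y i2 x ^+ 2); last first.
    by rewrite /C; field; rewrite !gt_eqF.
  move=> /le_trans; apply; rewrite le_eqVlt; apply/orP; left; apply/eqP.
  by field; rewrite !gt_eqF.
rewrite !ExD//; last exact: all_momentsD.
have bz i : 0 < c i -> Ex P (z i) <= K * C / 3.
  move=> ci; rewrite /z ExZ//.
  have w0 : 0 <= C / 3 / c i ^+ 3 by rewrite !divr_ge0 ?exprn_ge0 ?ltW.
  apply: le_trans (ler_wpM2l w0 (y6 i)) _.
  by rewrite le_eqVlt; apply/orP; left; apply/eqP; field; rewrite gt_eqF.
have := bz _ p0; have := bz _ p1; have := bz _ p2; rewrite /C; lra.
Qed.

(** * Inner product kernels of an abstract centred sample with covariance [M] *)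

Variables (d : nat) (J : finType) (e : J -> I) (W : J -> 'I_d -> T -> R).
Variables (M L : 'I_d -> 'I_d -> R) (K : R).
Hypothesis e_inj : injective e.
Hypothesis K0 : 0 <= K.
Hypothesis polW : forall j p, pol P G [set e j] (W j p).
Hypothesis meanW : forall j p, Ex P (W j p) = 0.
Hypothesis covW : forall j p q, Ex P (fun x => W j p x * W j q x) = M p q.
Hypothesis momW : forall j (v : 'I_d -> R),
  Ex P (fun x => (\sum_p W j p x * v p) ^+ 6) <= K * (\sum_p \sum_q v p * M p q * v q) ^+ 3.
Hypothesis ML : forall p q, M p q = \sum_k L p k * L q k.
Hypothesis degL : forall k, \sum_p \sum_q L p k * M p q * L q k = 0 ->
  forall j x, \sum_p W j p x * L p k = 0.

Let t2 : R := \sum_p \sum_q M p q ^+ 2.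
Let t3 : R := \sum_p \sum_q \sum_r M p q * M q r * M r p.

Let M_sym p q : M p q = M q p.
Proof. by rewrite !ML; apply: eq_bigr => k _; rewrite mulrC. Qed.

Lemma polW_sub (A : {set J}) j p : j \in A -> pol P G (e @: A) (W j p).
Proof. by move=> jA; apply: polS (polW j p); rewrite finset.sub1set imset_f. Qed.

Lemma imset_disj (A B : {set J}) : (forall j, j \in A -> j \notin B) ->
  forall i, i \in e @: A -> i \notin e @: B.
Proof.
move=> AB i /imsetP[j jA ->]; apply/imsetP => -[k kB /e_inj jk].
by move: (AB j jA); rewrite jk kB.
Qed.

Lemma quadform_sqr (v : 'I_d -> R) :
  \sum_p \sum_q v p * M p q * v q = \sum_k (\sum_p v p * L p k) ^+ 2.
Proof.
transitivity (\sum_p \sum_q \sum_k v p * L p k * (v q * L q k)).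
  apply: eq_bigr => p _; apply: eq_bigr => q _; rewrite ML mulr_sumr mulr_suml.
  by apply: eq_bigr => k _; ring.
transitivity (\sum_k \sum_p \sum_q v p * L p k * (v q * L q k)).
  by rewrite exchange_big/=; under eq_bigr do rewrite exchange_big/=;
    rewrite exchange_big; apply: eq_bigr => k _; rewrite exchange_big.
by apply: eq_bigr => k _; rewrite expr2 mulr_suml; apply: eq_bigr => p _; rewrite mulr_sumr.
Qed.

Lemma sum_quadform_L : \sum_k \sum_p \sum_q L p k * M p q * L q k = t2.
Proof.
rewrite /t2 exchange_big/=; apply: eq_bigr => p _.
rewrite exchange_big/=; apply: eq_bigr => q _.
rewrite expr2 [X in _ = _ * X]ML mulr_sumr; apply: eq_bigr => k _; ring.
Qed.

(** With [W l] frozen, [momW] leaves the cube of the quadratic form of [M] at [W l], which is the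
    sum of the [y k ^+ 2]. The variances [c k] of the [y k] add up to [t2], which keeps the bound
    free of the dimension. *)
Lemma Ex_inner_prod6 j l : j != l ->
  Ex P (fun x => (\sum_p W j p x * W l p x) ^+ 6) <= K ^+ 2 * t2 ^+ 3.
Proof.
move=> jl.
have AB i : i \in [set e j]%SET -> i \notin [set e l]%SET.
  by rewrite !inE => /eqP ->; rewrite (inj_eq e_inj).
have [m1 ->] := Ex_fubini_expr 6 (polW j) (polW l) AB.
have mW j' p := pol_all_moments (polW j' p).
pose y k x := \sum_p W l p x * L p k.
have my k : all_moments P (y k).
  by apply: all_moments_sum => p _; apply: all_momentsM => //; exact: all_moments_cst.
pose c k := \sum_p \sum_q L p k * M p q * L q k.
apply: (@le_trans _ _ (Ex P (fun x => K * (\sum_k y k x ^+ 2) ^+ 3))).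
  apply: Ex_le => //.
    by apply/all_momentsZ/all_momentsX/all_moments_sum => k _; exact: all_momentsX.
  by move=> t; rewrite -quadform_sqr; exact: momW.
rewrite ExZ; last first.
  by apply/all_momentsX/all_moments_sum => k _; exact: all_momentsX.
rewrite expr2 -mulrA ler_wpM2l// -sum_quadform_L.
apply: Ex_cube_sum_sqr_le => //.
- by move=> k; rewrite quadform_sqr; apply: sumr_ge0 => ? _; exact: sqr_ge0.
- by move=> k /degL h x; exact: h.
- by move=> k; exact: momW.
Qed.

Definition Wdiff (a b : J) p x : R := W a p x - W b p x.
(* [Dker] is the paper's [Lambda] and [hker] the product of its three factors. *)
Definition Dker (a b c f : J) x : R := \sum_p Wdiff a b p x * Wdiff c f p x.

Lemma pol_Wdiff (A : {set J}) a b p : a \in A -> b \in A -> pol P G (e @: A) (Wdiff a b p).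
Proof. by move=> aA bA; apply: polB; exact: polW_sub. Qed.

Lemma pol_Dker (A : {set J}) a b c f : a \in A -> b \in A -> c \in A -> f \in A ->
  pol P G (e @: A) (Dker a b c f).
Proof. by move=> *; apply: pol_sum => p _; apply: polM; exact: pol_Wdiff. Qed.

Lemma Ex_Wdiff2 a b p q : a != b -> Ex P (fun x => Wdiff a b p x * Wdiff a b q x) = 2 * M p q.
Proof.
move=> ab; have mW j p' := pol_all_moments (polW j p').
have cross a' b' p' q' : a' != b' -> Ex P (fun x => W a' p' x * W b' q' x) = 0.
  move=> ab'; rewrite (Ex_indep sub_meas indepG (polW a' p') (polW b' q')).
    by rewrite meanW mul0r.
  by move=> i; rewrite !inE => /eqP ->; rewrite (inj_eq e_inj).
transitivity (Ex P (fun x => (W a p x * W a q x - W a p x * W b q x) -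
    (W b p x * W a q x - W b p x * W b q x))).
  by congr Ex; apply/funext => x; rewrite /Wdiff; ring.
have mM a' b' p' q' : all_moments P (fun x => W a' p' x * W b' q' x) by exact: all_momentsM.
rewrite !ExB//; [|exact: all_momentsB..].
by rewrite !covW !cross// 1?eq_sym//; ring.
Qed.

Lemma Ex_Dker2 a b c f : uniq [:: a; b; c; f] -> Ex P (fun x => Dker a b c f x ^+ 2) = 4 * t2.
Proof.
rewrite /= !inE !negb_or -!andbA => /and4P[ab ac af /and3P[bc bf /andP[cf _]]].
have pU p q : pol P G (e @: [set a; b]%SET) (fun x => Wdiff a b p x * Wdiff a b q x).
  by apply: polM; apply: pol_Wdiff; rewrite !inE eqxx ?orbT.
have pV p q : pol P G (e @: [set c; f]%SET) (fun x => Wdiff c f p x * Wdiff c f q x).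
  by apply: polM; apply: pol_Wdiff; rewrite !inE eqxx ?orbT.
have AB := @imset_disj [set a; b]%SET [set c; f]%SET ltac:(by
  move=> j; rewrite !inE negb_or => /orP[] /eqP ->; rewrite ?ac ?af ?bc ?bf).
transitivity (Ex P (fun x => \sum_p \sum_q
    (Wdiff a b p x * Wdiff a b q x) * (Wdiff c f p x * Wdiff c f q x))).
  congr Ex; apply/funext => x; rewrite expr2 /Dker mulr_suml; apply: eq_bigr => p _.
  by rewrite mulr_sumr; apply: eq_bigr => q _; ring.
have mm p q : all_moments P (fun x =>
    (Wdiff a b p x * Wdiff a b q x) * (Wdiff c f p x * Wdiff c f q x)).
  exact: all_momentsM (pol_all_moments (pU p q)) (pol_all_moments (pV p q)).
rewrite Ex_sum => [|p _]; last exact: all_moments_sum.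
rewrite /t2 mulr_sumr; apply: eq_bigr => p _.
rewrite Ex_sum// mulr_sumr; apply: eq_bigr => q _.
by rewrite (Ex_indep sub_meas indepG (pU p q) (pV p q) AB) !Ex_Wdiff2//; ring.
Qed.

Lemma Ex_Dker6 a b c f : uniq [:: a; b; c; f] ->
  Ex P (fun x => Dker a b c f x ^+ 6) <= 4096 * K ^+ 2 * t2 ^+ 3.
Proof.
rewrite /= !inE !negb_or -!andbA => /and4P[ab ac af /and3P[bc bf /andP[cf _]]].
pose S j l x := \sum_p W j p x * W l p x.
have mW j p := pol_all_moments (polW j p).
have mS j l : all_moments P (S j l) by apply: all_moments_sum => p _; exact: all_momentsM.
have mS6 j l := all_momentsX 6 (mS j l).
have DE x : Dker a b c f x = S a c x - S a f x - S b c x + S b f x.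
  by rewrite /Dker /S -!sumrB -big_split/=; apply: eq_bigr => p _; rewrite /Wdiff; ring.
apply: (@le_trans _ _ (Ex P (fun x => 1024 * (S a c x ^+ 6 + S a f x ^+ 6 + S b c x ^+ 6 + S b f x ^+ 6)))).
  apply: Ex_le.
  - rewrite (funext (fun x => congr1 (fun z => z ^+ 6) (DE x))).
    by apply: all_momentsX; apply: all_momentsD => //; do 2 apply: all_momentsB => //.
  - by apply: all_momentsZ; do 3 apply: all_momentsD => //.
  - by move=> x; rewrite DE; exact: exprD6_le4.
rewrite ExZ; last by do 3 apply: all_momentsD => //.
rewrite ExD//; last by do 2 apply: all_momentsD => //.
rewrite ExD//; last by apply: all_momentsD => //.
rewrite ExD//.
have := Ex_inner_prod6 ac; have := Ex_inner_prod6 af.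
have := Ex_inner_prod6 bc; have := Ex_inner_prod6 bf; rewrite -/(S _ _).
by lra.
Qed.

Lemma Ex_Dker4 a b c f : uniq [:: a; b; c; f] -> 0 < t2 ->
  Ex P (fun x => Dker a b c f x ^+ 4) <= (4 + 4096 * K ^+ 2) * t2 ^+ 2.
Proof.
move=> u t20.
have mD : all_moments P (Dker a b c f).
  by apply: pol_all_moments; apply: (@pol_Dker [set: J]%SET); rewrite inE.
(* With [c = t2] in the interpolation both terms become multiples of [t2 ^+ 2]. *)
apply: (@le_trans _ _ (Ex P (fun x => t2 * Dker a b c f x ^+ 2 + t2^-1 * Dker a b c f x ^+ 6))).
  apply: Ex_le.
  - exact: all_momentsX.
  - by apply: all_momentsD; apply: all_momentsZ; exact: all_momentsX.
  - by move=> x; rewrite [X in _ + X]mulrC; exact: expr4_le.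
rewrite ExD; [|by apply: all_momentsZ; exact: all_momentsX..].
rewrite !ExZ; [|exact: all_momentsX..].
rewrite Ex_Dker2//.
have h : t2^-1 * Ex P (fun x => Dker a b c f x ^+ 6) <= t2^-1 * (4096 * K ^+ 2 * t2 ^+ 3).
  by rewrite ler_pM2l ?invr_gt0// Ex_Dker6.
apply: le_trans (lerD (lexx _) h) _.
by rewrite le_eqVlt; apply/orP; left; apply/eqP; field; rewrite gt_eqF.
Qed.

Definition hker (s : 'I_6 -> J) x : R :=
  let a := s (o6 0) in let b := s (o6 1) in let c := s (o6 2) in
  let f := s (o6 3) in let g := s (o6 4) in let h := s (o6 5) in
  Dker a b c f x * Dker c f g h x * Dker g h a b x.

Lemma pol_hker (A : {set J}) s : (forall i, s i \in A) -> pol P G (e @: A) (hker s).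
Proof. by move=> sA; do 2 (apply: polM; last exact: pol_Dker); exact: pol_Dker. Qed.

Lemma o6_neq i j : (i < 6)%N -> (j < 6)%N -> i != j -> o6 i != o6 j.
Proof. by move=> i6 j6 ij; rewrite /o6 -val_eqE/= !inordK. Qed.

(** Each of the three independent differences occurs in exactly two of the factors, so the
    expectation contracts to a cyclic product of three covariances [2 * M]. *)
Lemma Ex_hker s : injective s -> Ex P (hker s) = 8 * t3.
Proof.
move=> si; rewrite /hker.
have ne i j : (i < 6)%N -> (j < 6)%N -> i != j -> s (o6 i) != s (o6 j).
  by move=> *; rewrite (inj_eq si) o6_neq.
move: (ne 0 1 isT isT isT) (ne 0 2 isT isT isT) (ne 0 3 isT isT isT) (ne 0 4 isT isT isT)
  (ne 0 5 isT isT isT) (ne 1 2 isT isT isT) (ne 1 3 isT isT isT) (ne 1 4 isT isT isT)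
  (ne 1 5 isT isT isT) (ne 2 3 isT isT isT) (ne 2 4 isT isT isT) (ne 2 5 isT isT isT)
  (ne 3 4 isT isT isT) (ne 3 5 isT isT isT) (ne 4 5 isT isT isT).
move: (s (o6 0)) (s (o6 1)) (s (o6 2)) (s (o6 3)) (s (o6 4)) (s (o6 5)) => a b c f g h.
move=> ab ac af ag ah bc bf bg bh cf cg ch fg fh gh.
have pU (a' b' : J) p q : pol P G (e @: [set a'; b']%SET) (fun x => Wdiff a' b' p x * Wdiff a' b' q x).
  by apply: polM; apply: pol_Wdiff; rewrite !inE eqxx ?orbT.
have pV p q r : pol P G (e @: [set c; f; g; h]%SET)
    (fun x => (Wdiff c f p x * Wdiff c f q x) * (Wdiff g h q x * Wdiff g h r x)).
  by apply: polM; apply: polM; apply: pol_Wdiff; rewrite !inE eqxx ?orbT.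
have AB := @imset_disj [set a; b]%SET [set c; f; g; h]%SET ltac:(by
  move=> j; rewrite !inE !negb_or => /orP[] /eqP ->; rewrite ?ac ?af ?ag ?ah ?bc ?bf ?bg ?bh).
have CD := @imset_disj [set c; f]%SET [set g; h]%SET ltac:(by
  move=> j; rewrite !inE !negb_or => /orP[] /eqP ->; rewrite ?cg ?ch ?fg ?fh).
transitivity (Ex P (fun x => \sum_p \sum_q \sum_r
    (Wdiff a b p x * Wdiff a b r x) *
    ((Wdiff c f p x * Wdiff c f q x) * (Wdiff g h q x * Wdiff g h r x)))).
  congr Ex; apply/funext => x; rewrite /Dker -mulrA mulr_suml; apply: eq_bigr => p _.
  rewrite mulr_suml mulr_sumr; apply: eq_bigr => q _.
  by rewrite !mulr_sumr; apply: eq_bigr => r _; ring.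
have mm p q r : all_moments P (fun x => (Wdiff a b p x * Wdiff a b r x) *
    ((Wdiff c f p x * Wdiff c f q x) * (Wdiff g h q x * Wdiff g h r x))).
  exact: all_momentsM (pol_all_moments (pU a b p r)) (pol_all_moments (pV p q r)).
rewrite Ex_sum => [|p _]; last first.
  by apply: all_moments_sum => q _; exact: all_moments_sum.
rewrite /t3 mulr_sumr; apply: eq_bigr => p _.
rewrite Ex_sum => [|q _]; last exact: all_moments_sum.
rewrite mulr_sumr; apply: eq_bigr => q _.
rewrite Ex_sum// mulr_sumr; apply: eq_bigr => r _.
rewrite (Ex_indep sub_meas indepG (pU a b p r) (pV p q r) AB).
rewrite (Ex_indep sub_meas indepG (pU c f p q) (pU g h q r) CD) !Ex_Wdiff2//.
by rewrite (M_sym r p); ring.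
Qed.

(** The three factors share differences and are not independent; the arithmetic-geometric mean of
    their squares separates them at the price of sixth moments. *)
Lemma Ex_hker2 s : injective s -> Ex P (fun x => hker s x ^+ 2) <= 4096 * K ^+ 2 * t2 ^+ 3.
Proof.
move=> si.
have un (l : seq nat) : uniq l -> all (fun i => i < 6)%N l -> uniq [seq s (o6 i) | i <- l].
  move=> ul /allP l6; rewrite map_inj_in_uniq// => i j /l6 i6 /l6 j6 /si/eqP.
  by rewrite /o6 -val_eqE/= !inordK// => /eqP.
have u1 := un [:: 0; 1; 2; 3]%N isT isT; have u2 := un [:: 2; 3; 4; 5]%N isT isT.
have u3 := un [:: 4; 5; 0; 1]%N isT isT.
have mD a b c f : all_moments P (Dker a b c f).
  by apply: pol_all_moments; apply: (@pol_Dker [set: J]%SET); rewrite inE.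
have mD6 a b c f := all_momentsX 6 (mD a b c f).
have := Ex_Dker6 u1; have := Ex_Dker6 u2; have := Ex_Dker6 u3.
set D1 := Dker _ _ (s (o6 2)) _; set D2 := Dker _ _ (s (o6 4)) _; set D3 := Dker _ _ (s (o6 0)) _.
move=> h3 h2 h1.
have m1 : all_moments P (fun x => D1 x ^+ 6) by exact: mD6.
have m2 : all_moments P (fun x => D2 x ^+ 6) by exact: mD6.
have m3 : all_moments P (fun x => D3 x ^+ 6) by exact: mD6.
apply: (@le_trans _ _ (Ex P (fun x => 3^-1 * (D1 x ^+ 6 + D2 x ^+ 6 + D3 x ^+ 6)))).
  apply: Ex_le.
  - apply/all_momentsX/(@pol_all_moments _ _ _ _ _ G)/(@pol_hker [set: J]%SET) => i.
    by rewrite inE.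
  - by apply: all_momentsZ; do 2 apply: all_momentsD => //.
  move=> x; rewrite (_ : hker s x = D1 x * D2 x * D3 x)// !exprMn [leRHS]mulrC !(exprM _ 2 3).
  by apply: amgm3; exact: sqr_ge0.
rewrite ExZ; last by do 2 apply: all_momentsD => //.
rewrite ExD//; last by apply: all_momentsD => //.
rewrite ExD//; lra.
Qed.

End Sample.

(** * Variance of weighted kernel sums *)

Section WeightedSquare.
Context {R : realType} {dT : measure_display} {T : measurableType dT}.
Variable P : probability T R.
Variables (I : finType) (G : I -> set (set T)).
Hypothesis sub_meas : forall j A, <<s G j >> A -> measurable A.
Hypothesis indepG : forall A : I -> set T, (forall j, <<s G j >> (A j)) ->
  P (\bigcap_j A j) = (\prod_(j : I) P (A j))%E.

(* The cross terms of non-overlapping kernels vanish; all others are bounded by [V]. *)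
Lemma Ex_sqr_weighted_le (S : finType) (good : pred S) (ov : rel S)
    (A : S -> {set I}) (B : {set I}) (N g : S -> T -> R) (V : R) :
  (forall s, pol P G B (N s)) -> (forall s, pol P G (A s) (g s)) ->
  (forall s j, j \in A s -> j \notin B) ->
  (forall s x, 0 <= N s x) ->
  (forall s, ~~ good s -> forall s', Ex P (fun x => N s x * N s' x) = 0) ->
  (forall s, good s -> Ex P (g s) = 0) ->
  (forall s, good s -> Ex P (fun x => g s x ^+ 2) <= V) ->
  (forall s s', ~~ ov s s' -> forall j, j \in A s -> j \notin A s') ->
  Ex P (fun x => (\sum_s N s x * g s x) ^+ 2) <=
  V * \sum_s \sum_(s' | ov s s') Ex P (fun x => N s x * N s' x).
Proof.
move=> pN pg AB N0 bad g1 g2 ovA.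
have mN s := pol_all_moments (pN s); have mg s := pol_all_moments (pg s).
have EN s s' : 0 <= Ex P (fun x => N s x * N s' x) by apply: Ex_ge0 => x; exact: mulr_ge0.
have pgg s s' : pol P G (A s :|: A s') (fun x => g s x * g s' x).
  by apply: polM; apply: polS (pg _); [exact: finset.subsetUl|exact: finset.subsetUr].
have mm s s' : all_moments P (fun x => (N s x * N s' x) * (g s x * g s' x)).
  by apply: all_momentsM; exact: all_momentsM.
rewrite [leLHS](_ : _ = Ex P (fun x => \sum_s \sum_s' (N s x * N s' x) * (g s x * g s' x))); last first.
  congr Ex; apply/funext => x; rewrite expr2 mulr_suml; apply: eq_bigr => s _.
  by rewrite mulr_sumr; apply: eq_bigr => s' _; ring.
rewrite Ex_sum => [|s _]; last exact: all_moments_sum.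
rewrite mulr_sumr; apply: ler_sum => s _.
rewrite Ex_sum// mulr_sumr [leRHS]big_mkcond/=; apply: ler_sum => s' _.
rewrite (Ex_indep sub_meas indepG (polM (pN s) (pN s')) (pgg s s')); last first.
  move=> j jB; apply/negP; rewrite inE => /orP[] /AB; by rewrite jB.
(* Nothing is known about the kernel at a tuple that is not [good], but its weights have zero
   expectation. *)
have [gs|/bad b] := boolP (good s); last first.
  by rewrite b mul0r; case: ifP => // _; rewrite mulr0.
have [gs'|/bad b] := boolP (good s'); last first.
  have -> : Ex P (fun x => N s x * N s' x) = 0.
    by rewrite -(b s); congr Ex; apply/funext => x; rewrite mulrC.
  by rewrite mul0r; case: ifP => // _; rewrite mulr0.
case: ifPn => [_|/ovA sep]; last first.
  by rewrite (Ex_indep sub_meas indepG (pg s) (pg s') sep) g1// mul0r mulr0.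
rewrite mulrC ler_wpM2r//.
apply: (@le_trans _ _ (Ex P (fun x => 2^-1 * (g s x ^+ 2 + g s' x ^+ 2)))).
  apply: Ex_le.
  - exact: all_momentsM.
  - by apply: all_momentsZ; apply: all_momentsD; exact: all_momentsX.
  - by move=> x; have := sqr_ge0 (g s x - g s' x); nra.
rewrite ExZ; last by apply: all_momentsD; exact: all_momentsX.
rewrite ExD; [|exact: all_momentsX..].
by have := g2 _ gs; have := g2 _ gs'; lra.
Qed.

End WeightedSquare.

(** * Counting overlapping subsamples *)

Section Overlap.
Context {R : realType}.
Variables (a : nat) (n : 'I_a -> nat) (m : nat).

Definition subsample := {i : 'I_a & {ffun 'I_m.+1 -> 'I_(n i)}}.
Definition obs (s : subsample) (k : 'I_m.+1) : {i : 'I_a & 'I_(n i)} :=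
  Tagged (fun i => 'I_(n i)) (tagged s k).
Definition overlap (s s' : subsample) : bool := [exists k, exists l, obs s k == obs s' l].

Lemma card_ffun_fixed N (k : 'I_m.+1) (x : 'I_N) :
  \sum_(f : {ffun 'I_m.+1 -> 'I_N}) (f k == x)%:R = N%:R ^+ m :> R.
Proof.
pose F (i : 'I_m.+1) (y : 'I_N) : R := if i == k then (y == x)%:R else 1.
transitivity (\sum_(f : {ffun 'I_m.+1 -> 'I_N}) \prod_i F i (f i)).
  apply: eq_bigr => f _; rewrite (bigD1 k)//= /F eqxx big1 ?mulr1// => i /negbTE ->//.
rewrite -bigA_distr_bigA (bigD1 k)//= {1}/F eqxx.
rewrite (bigD1 x)//= eqxx big1 ?addr0 ?mul1r; last by move=> y /negbTE ->.
rewrite (eq_bigr (fun=> N%:R)).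
  by rewrite prodr_const cardC1 card_ord.
move=> i /negbTE ik; rewrite /F ik sumr_const card_ord//.
Qed.

Lemma overlap_tag s s' : overlap s s' -> tag s = tag s'.
Proof. by move=> /existsP[k /existsP[l /eqP /(congr1 tag)]]. Qed.

(** There are [n i ^ m.+1] tuples in group [i], and each meets at most [m.+1 ^ 2 * n i ^ m] others:
    choose the two coinciding positions, then the free entries. The term [r] accounts for a tuple
    paired with itself. *)
Lemma sum_overlap_le (F : subsample -> subsample -> R) (c : 'I_a -> R) (r : subsample -> R) :
  (forall i, 0 <= c i) -> (forall s, 0 <= r s) ->
  (forall s s', overlap s s' -> F s s' <= c (tag s) + (if s == s' then r s else 0)) ->
  \sum_s \sum_(s' | overlap s s') F s s' <=
  \sum_i c i * (m.+1%:R ^+ 2 * (n i)%:R ^+ (m.+1 + m)) + \sum_s r s.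
Proof.
move=> c0 r0 hF.
apply: (@le_trans _ _ (\sum_s (\sum_(s' | overlap s s') c (tag s) + r s))).
  apply: ler_sum => s _.
  apply: (@le_trans _ _ (\sum_(s' | overlap s s') (c (tag s) + (if s == s' then r s else 0)))).
    by apply: ler_sum => s'; exact: hF.
  rewrite big_split/= lerD2l.
  rewrite big_mkcond (bigD1 s)//= eqxx big1 ?addr0; last first.
    by move=> s' ss'; rewrite eq_sym (negbTE ss') if_same.
  by case: ifP.
rewrite big_split/= lerD2r.
have step s : \sum_(s' | overlap s s') c (tag s) <=
    c (tag s) * (m.+1%:R ^+ 2 * (n (tag s))%:R ^+ m).
  (* Union bound over the pairs of positions at which the two tuples can coincide. *)
  apply: (@le_trans _ _ (\sum_s' \sum_k \sum_l c (tag s) * (obs s k == obs s' l)%:R)).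
    rewrite big_mkcond; apply: ler_sum => s' _; case: ifP => [|_]; last first.
      by apply: sumr_ge0 => k _; apply: sumr_ge0 => l _; rewrite mulr_ge0.
    move=> /existsP[k /existsP[l kl]].
    rewrite (bigD1 k)//= (bigD1 l)//= kl mulr1 -addrA lerDl addr_ge0//.
      by apply: sumr_ge0 => l' _; rewrite mulr_ge0.
    by apply: sumr_ge0 => k' _; apply: sumr_ge0 => l' _; rewrite mulr_ge0.
  rewrite exchange_big/=.
  rewrite (_ : c (tag s) * _ = \sum_(k < m.+1) \sum_(l < m.+1) c (tag s) * (n (tag s))%:R ^+ m); last first.
    rewrite !sumr_const !card_ord -[RHS]mulr_natr -[X in _ = X * _]mulr_natr.
    by rewrite [LHS]mulrA [LHS]mulrAC expr2 mulrA.
  apply: ler_sum => k _; rewrite exchange_big/=; apply: ler_sum => l _.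
  rewrite -mulr_sumr ler_wpM2l//.
  rewrite -(sig_big_dep (fun=> true) (fun _ _ => true)
     (fun i (f : {ffun 'I_m.+1 -> 'I_(n i)}) =>
        (obs s k == obs (Tagged (fun i => {ffun 'I_m.+1 -> 'I_(n i)}) f) l)%:R))/=.
  rewrite (bigD1 (tag s))//= [X in _ + X]big1 ?addr0; last first.
    move=> i ine; rewrite big1// => f _.
    case: eqP => // /(congr1 tag)/= e; by rewrite -e eqxx in ine.
  rewrite -(card_ffun_fixed l (tagged s k)) le_eqVlt; apply/orP; left; apply/eqP.
  apply: eq_bigr => f _; rewrite /obs/= eq_sym; congr (_%:R).
  by rewrite eq_Tagged.
apply: (le_trans (ler_sum _ (fun s _ => step s))).
rewrite -(sig_big_dep (fun=> true) (fun _ _ => true)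
   (fun i (f : {ffun 'I_m.+1 -> 'I_(n i)}) => c i * (m.+1%:R ^+ 2 * (n i)%:R ^+ m)))/=.
apply: ler_sum => i _; rewrite sumr_const card_ffun !card_ord.
rewrite le_eqVlt; apply/orP; left; apply/eqP.
by rewrite -[LHS]mulr_natr natrX -mulrA -[X in _ * X = _]mulrA -exprD addnC.
Qed.

End Overlap.

(** * Falling factorials and sums over ordered tuples *)

Section Counting.
Context {R : realType}.

(** Each factor [N - j] with [j <= 5] is at least [N / 6] once [N >= 6]. *)
Lemma expn_le_ffact N k : (6 <= N)%N -> (k <= 6)%N -> (N ^ k <= 6 ^ k * N ^_ k)%N.
Proof.
move=> N6; elim: k => [|k ih] k6; first by rewrite ffactn0.
rewrite ffactnSr !expnSr mulnACA leq_mul ?ih ?(ltnW k6)//.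
by lia.
Qed.

Lemma sum_sym_offdiag N (H : 'I_N -> 'I_N -> R) :
  (forall i j, H i j = H j i) -> (forall i, H i i = 0) ->
  \sum_i \sum_j H i j = 2 * \sum_(i < N) \sum_(j < N | (j < i)%N) H i j.
Proof.
move=> Hs H0.
have e : \sum_(i < N) \sum_(j < N | (i < j)%N) H i j = \sum_(i < N) \sum_(j < N | (j < i)%N) H i j.
  rewrite (exchange_big_dep predT)//=; apply: eq_bigr => i _; exact: eq_bigr.
rewrite mulr_natl mulr2n -{1}e -big_split/=; apply: eq_bigr => i _.
rewrite (bigID (fun j : 'I_N => (i < j)%N))/=; congr (_ + _).
rewrite (bigID (fun j : 'I_N => (j < i)%N))/= [X in _ + X]big1 ?addr0.
  by apply: eq_bigl => j; rewrite -leqNgt; case: ltngtP.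
move=> j; rewrite -!leqNgt -eqn_leq => /eqP ij.
by rewrite (_ : j = i) ?H0//; exact: val_inj.
Qed.

Definition o4 (k : nat) : 'I_4 := inord k.

Lemma injective4 (A : eqType) (f : {ffun 'I_4 -> A}) :
  injectiveb f = uniq [:: f (o4 0); f (o4 1); f (o4 2); f (o4 3)].
Proof.
rewrite /injectiveb /dinjectiveb.
have -> : enum 'I_4 = [:: o4 0; o4 1; o4 2; o4 3].
  apply: (inj_map val_inj); rewrite val_enum_ord /=.
  by rewrite /o4 !inordK.
by [].
Qed.

Lemma sum_ffun4 N (F : 'I_N -> 'I_N -> 'I_N -> 'I_N -> R) :
  \sum_(f : {ffun 'I_4 -> 'I_N}) F (f (o4 0)) (f (o4 1)) (f (o4 2)) (f (o4 3)) =
  \sum_l1 \sum_l2 \sum_k1 \sum_k2 F l1 l2 k1 k2.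
Proof.
pose h (p : ('I_N * 'I_N) * ('I_N * 'I_N)) : {ffun 'I_4 -> 'I_N} :=
  [ffun i : 'I_4 => nth p.1.1 [:: p.1.1; p.1.2; p.2.1; p.2.2] i].
pose h' (f : {ffun 'I_4 -> 'I_N}) := ((f (o4 0), f (o4 1)), (f (o4 2), f (o4 3))).
have hE p : h' (h p) = p.
  by case: p => [[? ?] [? ?]]; rewrite /h' /h !ffunE /o4 !inordK.
have hE' f : h (h' f) = f.
  apply/ffunP => i; rewrite /h ffunE /=.
  have -> : i = o4 i by rewrite /o4 inord_val.
  case: i => [[|[|[|[|//]]]] ?] /=; rewrite /o4 inordK//=.
rewrite (reindex h); last first.
  by exists h' => x _; [exact: hE|exact: hE'].
rewrite (eq_bigr (fun p => F p.1.1 p.1.2 p.2.1 p.2.2)); last first.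
  by move=> p _; rewrite /h !ffunE /o4 !inordK.
rewrite -(pair_bigA _ (fun p q => F p.1 p.2 q.1 q.2))/=.
rewrite -(pair_bigA _ (fun l1 l2 => \sum_(q : 'I_N * 'I_N) F l1 l2 q.1 q.2))/=.
apply: eq_bigr => l1 _; apply: eq_bigr => l2 _.
by rewrite -(pair_bigA _ (fun k1 k2 => F l1 l2 k1 k2)).
Qed.

(** Symmetry within each of the two pairs makes the four orderings contribute equally. It turns the
    ordered sum in [A2] into a sum over injective tuples. *)
Lemma sum_inj4_sym N (F : 'I_N -> 'I_N -> 'I_N -> 'I_N -> R) :
  (forall l1 l2 k1 k2, F l1 l2 k1 k2 = F l2 l1 k1 k2) ->
  (forall l1 l2 k1 k2, F l1 l2 k1 k2 = F l1 l2 k2 k1) ->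
  \sum_(f : {ffun 'I_4 -> 'I_N}) (injectiveb f)%:R *
      F (f (o4 0)) (f (o4 1)) (f (o4 2)) (f (o4 3)) =
  4 * \sum_(l1 < N) \sum_(l2 < N) \sum_(k1 < N)
    \sum_(k2 < N | [&& uniq [:: l1; l2; k1; k2], (l2 < l1)%N & (k2 < k1)%N]) F l1 l2 k1 k2.
Proof.
move=> F1 F2.
pose U (l1 l2 k1 k2 : 'I_N) := uniq [:: l1; l2; k1; k2].
pose H l1 l2 k1 k2 := (U l1 l2 k1 k2)%:R * F l1 l2 k1 k2.
have U1 l1 l2 k1 k2 : U l1 l2 k1 k2 = U l2 l1 k1 k2.
  by apply: perm_uniq; exact: (permEl (perm_catCA [:: l1] [:: l2] [:: k1; k2])).
have U2 l1 l2 k1 k2 : U l1 l2 k1 k2 = U l1 l2 k2 k1.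
  apply: perm_uniq; rewrite !perm_cons; exact: (permEl (perm_catC [:: k1] [:: k2])).
under eq_bigr do rewrite injective4.
rewrite (sum_ffun4 H) (sum_sym_offdiag (H := fun l1 l2 => \sum_k1 \sum_k2 H l1 l2 k1 k2)); last 2 first.
- by move=> i j; apply: eq_bigr => k1 _; apply: eq_bigr => k2 _; rewrite /H U1 F1.
- move=> i; rewrite big1// => k1 _; rewrite big1// => k2 _.
  by rewrite /H /U /= inE eqxx mul0r.
rewrite (_ : 4 = 2 * 2 :> R); last by ring.
rewrite -mulrA; congr (_ * _); rewrite mulr_sumr; apply: eq_bigr => l1 _.
rewrite mulr_sumr big_mkcond; apply: eq_bigr => l2 _.
case: ifPn => l21; last first.
  rewrite big1 ?mulr0// => k1 _; rewrite big1// => k2.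
  by rewrite andbF.
rewrite sum_sym_offdiag; last 2 first.
- by move=> i j; rewrite /H U2 F2.
- by move=> i; rewrite /H /U /= !inE !eqxx/= !andbF mul0r.
congr (_ * _); apply: eq_bigr => k1 _; rewrite big_mkcond [RHS]big_mkcond.
apply: eq_bigr => k2 _; rewrite /= andbC; case: (k2 < k1)%N => //=.
by rewrite /H /U/=; case: ifP; rewrite ?mul1r ?mul0r.
Qed.

End Counting.

(** * The estimators *)

Section Model.
Context {R : realType} {dT : measure_display} {T : measurableType dT}.
Variables (P : probability T R) (a d : nat) (n : 'I_a -> nat)
  (mu : 'I_a -> 'cV[R]_d) (Sig TS : 'M[R]_d) (TW : 'M[R]_a) (ups : R).
Unset Implicit Arguments.
Variable X : forall i : 'I_a, 'I_(n i) -> 'I_d -> T -> R.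
Variable sig : forall i : 'I_a, 'I_(wsub ups n i) -> T -> {ffun 'I_6 -> 'I_(n i)}.
Set Implicit Arguments.
Hypothesis model : model_hyp P mu Sig TS TW X sig.

Let n6 i : (6 <= n i)%N. Proof. by have [[+ _ _ _ _] _] := model; apply. Qed.
Let ups0 : 0 < ups. Proof. by have [[_ + _ _ _] _] := model. Qed.
Let hTW : sym_idem_nz TW. Proof. by have [[_ _ + _ _] _] := model. Qed.
Let hTS : sym_idem_nz TS. Proof. by have [[_ _ _ + _] _] := model. Qed.
Let hSig : posdef Sig. Proof. by have [[_ _ _ _ +] _] := model. Qed.
Let mX i j k : measurable_fun setT (X i j k).
Proof. by have [_ [+ _ _ _]] := model; apply. Qed.
Let gaussX i (j : 'I_(n i)) : gaussian_vec P (vecX X j) (mu i) Sig.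
Proof. by have [_ [_ + _ _]] := model; apply. Qed.
Let unif i b : uniform_subsample P (sig i b).
Proof. by have [_ [_ _ + _]] := model; apply. Qed.

Notation J := {i : 'I_a & 'I_(n i)}.
Notation Ssig := {i : 'I_a & 'I_(wsub ups n i)}.
Notation I := (J + Ssig)%type.

(** These generate the sigma-algebras of [sigma_family]; [adapted] takes the generators and not the
    sigma-algebra itself. *)
Definition gen (j : I) : set (set T) :=
  match j with
  | inl p => [set A | exists k (B : set R), measurable B /\ A = X (tag p) (tagged p) k @^-1` B]
  | inr p => [set A | exists s, A = [set t | sig (tag p) (tagged p) t = s]]
  end.

Lemma gen_sub_meas j A : <<s gen j >> A -> measurable A.
Proof.
apply: smallest_sub; first exact: sigma_algebra_measurable.
case: j => p B /=.
  by move=> [k [C [mC ->]]]; rewrite -[_ @^-1` _]setTI; exact: mX.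
by move=> [s ->]; have [] := unif (tagged p) s.
Qed.

Lemma gen_indep (A : I -> set T) : (forall j, <<s gen j >> (A j)) ->
  P (\bigcap_j A j) = (\prod_(j : I) P (A j))%E.
Proof.
move=> hA; have [_ [_ _ _ ind]] := model.
by apply: (ind A) => -[p|p]; [exact: (hA (inl p))|exact: (hA (inr p))].
Qed.

Definition zvec (j : J) x : 'cV[R]_d := vecX X (tagged j) x - mu (tag j).
Definition lin (u : 'cV[R]_d) (j : J) x : R := dotv u (zvec j x).

Let qf (u : 'cV[R]_d) := dotv u (Sig *m u).

Lemma dotvDl (u v w : 'cV[R]_d) : dotv (u + v) w = dotv u w + dotv v w.
Proof. by rewrite /dotv linearD/= mulmxDl mxE. Qed.

Lemma dotvBl (u v w : 'cV[R]_d) : dotv (u - v) w = dotv u w - dotv v w.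
Proof. by rewrite /dotv linearB/= mulmxBl !mxE. Qed.

Lemma dotvBr (u v w : 'cV[R]_d) : dotv u (v - w) = dotv u v - dotv u w.
Proof. by rewrite /dotv mulmxBr !mxE. Qed.

Lemma dotvDr (u v w : 'cV[R]_d) : dotv u (v + w) = dotv u v + dotv u w.
Proof. by rewrite /dotv mulmxDr mxE. Qed.

Lemma dotv0l (w : 'cV[R]_d) : dotv 0 w = 0.
Proof. by rewrite /dotv linear0 mul0mx mxE. Qed.

Lemma dotv_sym (u v : 'cV[R]_d) : dotv u v = dotv v u.
Proof. by rewrite !dotvE; apply: eq_bigr => k _; rewrite mulrC. Qed.

Lemma lin_moments u j : [/\ all_moments P (lin u j), Ex P (lin u j) = 0,
  Ex P (fun x => lin u j x ^+ 2) = qf u & Ex P (fun x => lin u j x ^+ 6) <= 1024 * qf u ^+ 3].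
Proof.
(* [gaussian_vec] speaks of nonzero [u] only. *)
have [->|u0] := eqVneq u 0.
  have l0 : lin 0 j = fun=> 0 by apply/funext => x; rewrite /lin dotv0l.
  rewrite l0 !Ex_cst /qf dotv0l !expr0n/= mulr0; split => //; exact: all_moments_cst.
have q0 : 0 < qf u by have [_ /(_ _ u0)] := hSig.
set s := Num.sqrt (qf u); have s0 : 0 < s by rewrite sqrtr_gt0.
have s2 : s ^+ 2 = qf u by rewrite sqr_sqrtr// ltW.
pose V x := dotv u (vecX X (tagged j) x).
have mV : measurable_fun setT V.
  rewrite (_ : V = fun x => \sum_k u k 0 * X (tag j) (tagged j) k x); last first.
    by apply/funext => x; rewrite /V dotvE; apply: eq_bigr => k _; rewrite mxE.
  by apply: measurable_sum => k; apply: measurable_funM => //; exact: mX.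
have law := gaussX (tagged j) u0.
have mY := normal_all_moments mV s0 law.
have E1 := Ex_normal1 mV s0 law; have E2 := Ex_normal2 mV s0 law.
have E6 := Ex_normal6 mV s0 law.
set Y := (fun x => _) in mY E1.
have YE x : lin u j x = s * Y x.
  by rewrite /lin /zvec dotvBr /Y mulrC divfK// gt_eqF.
rewrite (funext YE); split.
- exact: all_momentsZ.
- by rewrite ExZ// E1 mulr0.
- rewrite (_ : (fun x => _) = fun x => s ^+ 2 * Y x ^+ 2); last first.
    by apply/funext => x; rewrite exprMn.
  by rewrite ExZ ?E2 ?mulr1//; exact: all_momentsX.
- rewrite (_ : (fun x => _) = fun x => s ^+ 6 * Y x ^+ 6); last first.
    by apply/funext => x; rewrite exprMn.
  rewrite ExZ; last exact: all_momentsX.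
  by rewrite (exprM s 2 3) s2 mulrC ler_pM2r ?exprn_gt0.
Qed.

(** Polarisation: the law provides the variance of each single linear form. *)
Lemma lin_cov u v j : Ex P (fun x => lin u j x * lin v j x) = dotv u (Sig *m v).
Proof.
have m1 w : all_moments P (fun x => lin w j x ^+ 2).
  by apply: all_momentsX; have [] := lin_moments w j.
transitivity (Ex P (fun x => 4^-1 * (lin (u + v) j x ^+ 2 - lin (u - v) j x ^+ 2))).
  congr Ex; apply/funext => x; rewrite /lin dotvDl dotvBl.
  by move: (dotv u _) (dotv v _) => p q; field.
rewrite ExZ; last exact: all_momentsB.
rewrite ExB//; have [_ _ -> _] := lin_moments (u + v) j; have [_ _ -> _] := lin_moments (u - v) j.
have sym : dotv v (Sig *m u) = dotv u (Sig *m v).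
  have [sS _] := hSig.
  by rewrite dotv_sym /dotv trmx_mul sS mulmxA.
have -> : qf (u + v) = qf u + qf v + 2 * dotv u (Sig *m v).
  by rewrite /qf mulmxDr dotvDl !dotvDr sym; ring.
have -> : qf (u - v) = qf u + qf v - 2 * dotv u (Sig *m v).
  by rewrite /qf mulmxBr dotvBl !dotvBr sym; ring.
by field.
Qed.

Definition Wobs (j : J) (p : 'I_d) x : R := (TS *m zvec j x) p 0.

Lemma Wobs_lin j p x : Wobs j p x = lin (TS *m delta_mx p 0) j x.
Proof.
have [sT _ _] := hTS.
by rewrite /lin /dotv trmx_mul sT -mulmxA trmx_delta -rowE [RHS]mxE.
Qed.

Lemma sum_Wobs (v : 'I_d -> R) j x :
  \sum_p Wobs j p x * v p = lin (TS *m \col_p v p) j x.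
Proof.
have [sT _ _] := hTS.
rewrite /lin /dotv trmx_mul sT -mulmxA [RHS]mxE.
by apply: eq_bigr => p _; rewrite mulrC; congr (_ * _); rewrite !mxE.
Qed.

Lemma pol_Wobs j p : pol P gen [set (inl j : I)] (Wobs j p).
Proof.
rewrite (_ : Wobs j p = fun x => \sum_k TS p k * (X (tag j) (tagged j) k x - mu (tag j) k 0)); last first.
  by apply/funext => x; rewrite /Wobs mxE; apply: eq_bigr => k _; rewrite !mxE.
apply: pol_sum => k _; apply: polZ; apply: pol1.
  have [m1 _ _ _] := lin_moments (delta_mx k 0) j.
  rewrite (_ : (fun x => _) = lin (delta_mx k 0) j)//; apply/funext => x.
  rewrite /lin dotvE (bigD1 k)//= big1 ?addr0 => [|l lk].
    by rewrite !mxE !eqxx mul1r.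
  by rewrite mxE (negbTE lk) mul0r.
apply: measurable_funB; last exact: measurable_cst.
move=> _ B mB; rewrite setTI; apply: sub_sigma_algebra.
by exists k, B.
Qed.

Let M := projcov TS Sig.
Let t2 := \tr (M *m M).
Let t3 := \tr (M *m M *m M).

Lemma Ex_Wobs j p : Ex P (Wobs j p) = 0.
Proof. by rewrite (funext (Wobs_lin j p)); have [] := lin_moments (TS *m delta_mx p 0) j. Qed.

Lemma dotv_projcov (u v : 'cV[R]_d) :
  dotv (TS *m u) (Sig *m (TS *m v)) = \sum_p \sum_q u p 0 * M p q * v q 0.
Proof.
have [sT _ _] := hTS.
rewrite /dotv (_ : _ *m _ = u^T *m M *m v); last first.
  by rewrite trmx_mul sT /M /projcov !mulmxA.
rewrite mxE.
rewrite exchange_big/=; apply: eq_bigr => q _; rewrite mxE mulr_suml.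
by apply: eq_bigr => p _; rewrite [u^T _ _]mxE.
Qed.

Lemma Ex_Wobs2 j p q : Ex P (fun x => Wobs j p x * Wobs j q x) = M p q.
Proof.
transitivity (Ex P (fun x => lin (TS *m delta_mx p 0) j x * lin (TS *m delta_mx q 0) j x)).
  by congr Ex; apply/funext => x; rewrite !Wobs_lin.
rewrite lin_cov dotv_projcov (bigD1 p)//= (bigD1 q)//= !big1 ?addr0.
- by rewrite !mxE !eqxx mul1r mulr1.
- by move=> k kp; rewrite big1// => l _; rewrite !mxE (negbTE kp) !mul0r.
- by move=> k kq; rewrite !mxE (negbTE kq) mulr0.
Qed.

Lemma Ex_Wobs6 j (v : 'I_d -> R) :
  Ex P (fun x => (\sum_p Wobs j p x * v p) ^+ 6) <=
  1024 * (\sum_p \sum_q v p * M p q * v q) ^+ 3.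
Proof.
have [_ _ _ h] := lin_moments (TS *m \col_p v p) j.
rewrite (_ : (fun x => _) = fun x => lin (TS *m \col_p v p) j x ^+ 6); last first.
  by apply/funext => x; rewrite sum_Wobs.
apply: le_trans h _; rewrite /qf dotv_projcov.
rewrite (_ : \sum_p _ = \sum_p \sum_q v p * M p q * v q)//.
by apply: eq_bigr => p _; apply: eq_bigr => q _; congr (_ * M p q * _); rewrite mxE.
Qed.

Lemma Dker_Yv i (l1 l2 k1 k2 : 'I_(n i)) x :
  dotv (Yv TS X l1 l2 x) (Yv TS X k1 k2 x) =
  Dker Wobs (Tagged (fun i => 'I_(n i)) l1) (Tagged (fun i => 'I_(n i)) l2)
    (Tagged (fun i => 'I_(n i)) k1) (Tagged (fun i => 'I_(n i)) k2) x.
Proof.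
have YE (l l' : 'I_(n i)) p : Yv TS X l l' x p 0 =
    Wdiff Wobs (Tagged (fun i => 'I_(n i)) l) (Tagged (fun i => 'I_(n i)) l') p x.
  rewrite /Wdiff /Wobs /Yv /zvec /= !mulmxBr !mxE; ring.
by rewrite dotvE /Dker; apply: eq_bigr => p _; rewrite !YE.
Qed.

(** As [TS] is symmetric and idempotent, the form in [A2] is an inner product of projected
    differences, so both estimators share one kernel. *)
Lemma Dker_quadform i (l1 l2 k1 k2 : 'I_(n i)) x :
  dotv (vecX X l1 x - vecX X l2 x) (TS *m (vecX X k1 x - vecX X k2 x)) =
  Dker Wobs (Tagged (fun i => 'I_(n i)) l1) (Tagged (fun i => 'I_(n i)) l2)
    (Tagged (fun i => 'I_(n i)) k1) (Tagged (fun i => 'I_(n i)) k2) x.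
Proof.
have [sT iT _] := hTS.
rewrite -Dker_Yv /dotv /Yv trmx_mul sT.
by rewrite -mulmxA (mulmxA TS TS) iT.
Qed.

Lemma Lam123_hker i (f : {ffun 'I_6 -> 'I_(n i)}) x :
  Lam123 TS X f x = hker Wobs (fun k => Tagged (fun i => 'I_(n i)) (f k)) x.
Proof. by rewrite /Lam123 /hker !Dker_Yv. Qed.

Lemma sum_projcov2 : \sum_p \sum_q M p q ^+ 2 = t2.
Proof. by rewrite /t2 -[X in _ *m X](projcov_sym hTS hSig) -frob2_tr. Qed.

Lemma sum_projcov3 : \sum_p \sum_q \sum_r M p q * M q r * M r p = t3.
Proof.
rewrite /t3 /mxtrace; apply: eq_bigr => p _; rewrite [RHS]mxE exchange_big/=.
by apply: eq_bigr => r _; rewrite [X in _ = X * _]mxE mulr_suml.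
Qed.

(** The second clause supplies what [Ex_cube_sum_sqr_le] asks of zero weights: a column of [L] with
    zero variance is annihilated by [TS]. *)
Lemma projcov_factor : exists L : 'I_d -> 'I_d -> R,
  (forall p q, M p q = \sum_k L p k * L q k) /\
  (forall k, \sum_p \sum_q L p k * M p q * L q k = 0 ->
     forall j x, \sum_p Wobs j p x * L p k = 0).
Proof.
have [L ML] := projcov_cholesky hTS hSig.
exists L; split=> [p q|k h j x].
  by rewrite /M ML mxE; apply: eq_bigr => k _; rewrite mxE.
rewrite sum_Wobs (_ : TS *m _ = 0) ?/lin ?dotv0l//.
apply: (projcov_form_eq0 hTS hSig); rewrite (projcov_form Sig hTS) dotv_projcov -[RHS]h.
by apply: eq_bigr => p _; apply: eq_bigr => q _; congr (_ * M p q * _); rewrite mxE.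
Qed.

Let inlJ (j : J) : I := inl j.
Let inlJ_inj : injective inlJ. Proof. by move=> ? ? []. Qed.

(* [1024] bounds the sixth moment of a standard normal variable; [4096 = 4 * 4 ^ 5]
   comes from splitting a kernel into four inner products. *)
Definition cK : R := 4096 * 1024 ^+ 2.

Lemma Dker_moments (j1 j2 j3 j4 : J) : uniq [:: j1; j2; j3; j4] ->
  Ex P (fun x => Dker Wobs j1 j2 j3 j4 x ^+ 2) = 4 * t2 /\
  Ex P (fun x => Dker Wobs j1 j2 j3 j4 x ^+ 4) <= (4 + cK) * t2 ^+ 2.
Proof.
move=> u; have [L [ML degL]] := projcov_factor.
have K0 := ler0n R 1024.
split.
  rewrite (Ex_Dker2 gen_sub_meas gen_indep inlJ_inj pol_Wobs Ex_Wobs Ex_Wobs2 u).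
  by rewrite sum_projcov2.
have := Ex_Dker4 gen_sub_meas gen_indep inlJ_inj K0 pol_Wobs Ex_Wobs Ex_Wobs2 Ex_Wobs6 ML degL u.
by rewrite sum_projcov2; apply; exact: tr_projcov2_gt0.
Qed.

Lemma hker_moments (s : 'I_6 -> J) : injective s ->
  Ex P (hker Wobs s) = 8 * t3 /\ Ex P (fun x => hker Wobs s x ^+ 2) <= cK * t2 ^+ 3.
Proof.
move=> si; have [L [ML degL]] := projcov_factor.
have K0 := ler0n R 1024.
split.
  rewrite (Ex_hker gen_sub_meas gen_indep inlJ_inj pol_Wobs Ex_Wobs Ex_Wobs2 ML si).
  by rewrite sum_projcov3.
have := Ex_hker2 gen_sub_meas gen_indep inlJ_inj K0 pol_Wobs Ex_Wobs6 ML degL si.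
by rewrite sum_projcov2.
Qed.


(** * [C1star] as a randomly weighted sum over all tuples *)

Notation Sub m := (subsample n m).
Notation w i := (wsub ups n i).

Let inlS (A : {set J}) : {set I} := [set inlJ j | j in A]%SET.
Let sigset : {set I} := [set j : I | if j is inr _ then true else false]%SET.

Let inlS_sig (A : {set J}) j : j \in inlS A -> j \notin sigset.
Proof. by move=> /imsetP[k _ ->]; rewrite inE. Qed.

Definition obs_set m (s : Sub m) : {set J} := [set obs s k | k : 'I_m.+1]%SET.

Lemma obs_inj m (s : Sub m) : injectiveb (tagged s) -> injective (obs s).
Proof.
move=> /injectiveP si k l /eqP; rewrite /obs eq_Tagged => /eqP; exact: si.
Qed.

Lemma obs_in m (s : Sub m) k : obs s k \in obs_set s.
Proof. by rewrite imset_f. Qed.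

Lemma overlap_disj m (s s' : Sub m) : ~~ overlap s s' ->
  forall j, j \in inlS (obs_set s) -> j \notin inlS (obs_set s').
Proof.
move=> nov j /imsetP[_ /imsetP[k _ ->] ->]; apply/negP => /imsetP[_ /imsetP[l _ ->] /inlJ_inj e].
by move: nov => /existsPn /(_ k) /existsPn /(_ l); rewrite e eqxx.
Qed.

Lemma Ex_center_sqr_le (f : T -> R) : all_moments P f ->
  Ex P (fun x => (f x - Ex P f) ^+ 2) <= Ex P (fun x => f x ^+ 2).
Proof.
move=> mf; set c := Ex P f.
rewrite (_ : (fun x => _) = fun x => f x ^+ 2 - ((2 * c) * f x - c ^+ 2)); last first.
  by apply/funext => x; ring.
have m1 : all_moments P (fun x => 2 * c * f x) by exact: all_momentsZ.
have m2 := all_moments_cst P (c ^+ 2).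
rewrite ExB; [|exact: all_momentsX|exact: all_momentsB].
rewrite ExB// Ex_cst ExZ// -/c lerBlDr lerDl.
by have := sqr_ge0 c; nra.
Qed.

Definition selected i b (f : {ffun 'I_6 -> 'I_(n i)}) : T -> R := \1_[set t | sig i b t = f].
(** The number of draws equal to [s]. With these weights the random indices leave the kernels, which
    then depend on the data alone. *)
Definition Nsub (s : Sub 5) x : R := \sum_(b < w (tag s)) selected b (tagged s) x.

Lemma selectedE i b (f : {ffun 'I_6 -> 'I_(n i)}) x : selected b f x = (sig i b x == f)%:R.
Proof.
rewrite /selected indicE; congr (nat_of_bool _)%:R; apply/idP/eqP; first by rewrite inE.
by move=> h; rewrite inE.
Qed.

Lemma selected_ge0 i b (f : {ffun 'I_6 -> 'I_(n i)}) x : 0 <= selected b f x.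
Proof. by rewrite selectedE. Qed.

Lemma pol_selected i b (f : {ffun 'I_6 -> 'I_(n i)}) :
  pol P gen [set (inr (Tagged (fun i => 'I_(w i)) b) : I)] (selected b f).
Proof.
apply: pol1; first by apply: all_moments_indic; have [] := unif b f.
apply: adapted_indic; apply: sub_sigma_algebra; by exists f.
Qed.

Lemma Ex_selected i b (f : {ffun 'I_6 -> 'I_(n i)}) :
  Ex P (selected b f) = if injectiveb f
       then ((n i ^_ 6)%:R)^-1 else 0.
Proof.
have [mf Pf] := unif b f; rewrite /selected Ex_indic// Pf; case: ifP => //= _.
congr (_%:R^-1); have := card_inj_ffuns 'I_6 'I_(n i); rewrite !card_ord => <-.
by apply: eq_card => s; apply/idP/idP; rewrite !inE.
Qed.

Lemma Ex_selected_le i b (f : {ffun 'I_6 -> 'I_(n i)}) :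
  Ex P (selected b f) <= 6 ^+ 6 / (n i)%:R ^+ 6.
Proof.
have n0 : 0 < (n i)%:R :> R by rewrite ltr0n; apply: leq_trans (n6 i).
rewrite Ex_selected; case: ifP => _; last by rewrite divr_ge0// exprn_ge0.
have f0 : 0 < (n i ^_ 6)%:R :> R by rewrite ltr0n ffact_gt0.
rewrite ler_pdivlMr ?exprn_gt0// mulrC ler_pdivrMr//.
by rewrite -!natrX -natrM ler_nat expn_le_ffact.
Qed.

Lemma pol_Nsub s : pol P gen sigset (Nsub s).
Proof.
apply: pol_sum => b _; apply: polS (pol_selected _ _).
by rewrite finset.sub1set inE.
Qed.

Lemma Nsub_ge0 s x : 0 <= Nsub s x.
Proof. by apply: sumr_ge0 => b _; exact: selected_ge0. Qed.

Lemma Nsub_le s x : Nsub s x <= (w (tag s))%:R.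
Proof.
apply: (@le_trans _ _ (\sum_(b < w (tag s)) 1)).
  by apply: ler_sum => b _; rewrite selectedE; case: eqP.
by rewrite sumr_const card_ord.
Qed.

Lemma sum_sub m (F : Sub m -> R) :
  \sum_(s : Sub m) F s =
  \sum_i \sum_(f : {ffun 'I_m.+1 -> 'I_(n i)}) F (Tagged (fun i => {ffun 'I_m.+1 -> 'I_(n i)}) f).
Proof.
rewrite (sig_big_dep (fun=> true) (fun _ _ => true)
  (fun i f => F (Tagged (fun i => {ffun 'I_m.+1 -> 'I_(n i)}) f)))/=.
by apply: eq_bigr => -[].
Qed.

Lemma sum_selected i b (F : {ffun 'I_6 -> 'I_(n i)} -> R) x :
  \sum_f selected b f x * F f = F (sig i b x).
Proof.
rewrite (bigD1 (sig i b x))//= big1 ?addr0; first by rewrite selectedE eqxx mul1r.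
by move=> f fs; rewrite selectedE eq_sym (negbTE fs) mul0r.
Qed.

Lemma sum_Nsub_mul (F : Sub 5 -> R) x :
  \sum_s Nsub s x * F s =
  \sum_i \sum_(b < w i) F (Tagged (fun i => {ffun 'I_6 -> 'I_(n i)}) (sig i b x)).
Proof.
rewrite sum_sub; apply: eq_bigr => i _.
rewrite /Nsub /=; under eq_bigr do rewrite mulr_suml.
rewrite exchange_big/=; apply: eq_bigr => b _.
exact: (sum_selected b (fun f => F (Tagged (fun i => {ffun 'I_6 -> 'I_(n i)}) f))).
Qed.

Definition Wtot : R := \sum_i (w i)%:R.

Lemma sum_Nsub x : \sum_s Nsub s x = Wtot.
Proof.
under eq_bigr do rewrite -[Nsub _ _]mulr1.
rewrite (sum_Nsub_mul (fun=> 1)); apply: eq_bigr => i _.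
by rewrite sumr_const card_ord.
Qed.

Lemma C1star_sum x :
  C1star TS X sig x = (8 * Wtot)^-1 * \sum_s Nsub s x * hker Wobs (obs s) x.
Proof.
rewrite (sum_Nsub_mul (fun s => hker Wobs (obs s) x)) /C1star; congr (_ * _).
apply: eq_bigr => i _; apply: eq_bigr => b _; exact: Lam123_hker.
Qed.

(** A matrix without rows is 0, so [TW != 0] forces at least one group. *)
Lemma index_nonempty : exists i : 'I_a, True.
Proof.
have [_ _ TW0] := hTW.
have [//|no] := pselect (exists i : 'I_a, True).
by case/eqP: TW0; apply/matrixP => i; exfalso; apply: no; exists i.
Qed.

Lemma Wtot_gt0 : 0 < Wtot.
Proof.
have [i _] := index_nonempty.
rewrite /Wtot (bigD1 i)//= ltr_wpDr//; first by apply: sumr_ge0 => k _; exact: ler0n.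
have c0 : 0 < ups * 'C(n i, 6)%:R by rewrite mulr_gt0// ltr0n bin_gt0.
by rewrite ltr0n absz_gt0 gt_eqF// ceil_gt0.
Qed.

Lemma mom_hker s : all_moments P (hker Wobs s).
Proof.
apply: (@pol_all_moments _ _ _ _ _ gen (inlS [set: J]%SET)).
by apply: (pol_hker pol_Wobs) => i; rewrite inE.
Qed.

Lemma Ex_Nsub_bad (s : Sub 5) : ~~ injectiveb (tagged s) -> Ex P (Nsub s) = 0.
Proof.
move=> ns; rewrite Ex_sum; last by move=> b _; exact: pol_all_moments (pol_selected _ _).
by rewrite big1// => b _; rewrite Ex_selected (negbTE ns).
Qed.

(** The other count is at most the number of draws in its group, so the product is dominated by a
    multiple of [Nsub s]. *)
Lemma Ex_Nsub2_bad (s : Sub 5) : ~~ injectiveb (tagged s) ->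
  forall s', Ex P (fun x => Nsub s x * Nsub s' x) = 0.
Proof.
move=> /Ex_Nsub_bad ns s'.
have mN z := pol_all_moments (pol_Nsub z).
apply/eqP; rewrite eq_le; apply/andP; split; last first.
  by apply: Ex_ge0 => x; rewrite mulr_ge0 ?Nsub_ge0.
rewrite -[leRHS](mulr0 (w (tag s'))%:R) -ns -ExZ//.
apply: Ex_le; [exact: all_momentsM|exact: all_momentsZ|move=> x].
by rewrite mulrC ler_wpM2r ?Nsub_ge0 ?Nsub_le.
Qed.

Lemma sum_Ex_Nsub : \sum_s Ex P (Nsub s) = Wtot.
Proof.
rewrite -Ex_sum; last by move=> s _; exact: pol_all_moments (pol_Nsub s).
by rewrite (funext sum_Nsub) Ex_cst.
Qed.

(** The counts are independent of the data and add up to [Wtot], and every tuple of nonzero expected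
    count has kernel mean [8 * t3]. *)
Lemma Ex_C1star : Ex P (C1star TS X sig) = t3.
Proof.
have mN s := pol_all_moments (pol_Nsub s).
rewrite (funext C1star_sum) ExZ; last first.
  by apply: all_moments_sum => s _; exact: all_momentsM (mN s) (mom_hker _).
rewrite Ex_sum; last by move=> s _; exact: all_momentsM (mN s) (mom_hker _).
rewrite (eq_bigr (fun s => Ex P (Nsub s) * (8 * t3))); last first.
  move=> s _.
  have ph : pol P gen (inlS (obs_set s)) (hker Wobs (obs s)).
    by apply: (pol_hker pol_Wobs) => k; exact: obs_in.
  rewrite (Ex_indep gen_sub_meas gen_indep (pol_Nsub s) ph); last first.
    by move=> j js; apply/negP => /inlS_sig; rewrite js.
  have [/obs_inj si|/Ex_Nsub_bad ->] := boolP (injectiveb (tagged s)); last by rewrite !mul0r.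
  by have [-> _] := hker_moments si.
rewrite -mulr_suml sum_Ex_Nsub.
have W0 : Wtot != 0 by rewrite gt_eqF// Wtot_gt0.
by field.
Qed.

Lemma mom_C1star : all_moments P (C1star TS X sig).
Proof.
rewrite (funext C1star_sum); apply: all_momentsZ; apply: all_moments_sum => s _.
exact: all_momentsM (pol_all_moments (pol_Nsub s)) (mom_hker _).
Qed.

Let q i : R := 6 ^+ 6 / (n i)%:R ^+ 6.

(** Two different draws are independent and each hits its tuple with probability at most [q], which
    gives the first term. A single draw can equal both tuples only if they coincide, which gives the
    second. *)
Lemma Ex_Nsub2_le (s s' : Sub 5) : overlap s s' ->
  Ex P (fun x => Nsub s x * Nsub s' x) <=
  (w (tag s))%:R ^+ 2 * q (tag s) ^+ 2 + (if s == s' then Ex P (Nsub s) else 0).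
Proof.
move=> /overlap_tag; case: s => i f; case: s' => i' f' /= ii'.
subst i'; rewrite eq_Tagged/=.
have ms i0 b (g : {ffun 'I_6 -> 'I_(n i0)}) := pol_all_moments (pol_selected b g).
rewrite (_ : (fun x => _) = fun x => \sum_(b < w i) \sum_(b' < w i) selected b f x * selected b' f' x); last first.
  apply/funext => x; rewrite /Nsub/= mulr_suml; apply: eq_bigr => b _.
  by rewrite mulr_sumr.
have mss b b' : all_moments P (fun x => selected b f x * selected b' f' x).
  exact: all_momentsM.
rewrite Ex_sum; last by move=> b _; exact: all_moments_sum.
have q0 : 0 <= q i by rewrite divr_ge0// exprn_ge0.
have step b : Ex P (fun x => \sum_(b' < w i) selected b f x * selected b' f' x) <=
    (w i)%:R * q i ^+ 2 + (if f == f' then Ex P (selected b f) else 0).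
  rewrite Ex_sum// (bigD1 b)//= addrC; apply: lerD.
    apply: (@le_trans _ _ (\sum_(b' < w i | b' != b) q i ^+ 2)).
      apply: ler_sum => b' b'b.
      rewrite (Ex_indep gen_sub_meas gen_indep (pol_selected b f) (pol_selected b' f')); last first.
        move=> j; rewrite !inE => /eqP ->; apply/eqP => -[] /eqP.
        by rewrite eq_Tagged/= eq_sym (negbTE b'b).
      rewrite expr2; apply: ler_pM; try exact: Ex_selected_le; apply: Ex_ge0 => x; exact: selected_ge0.
    apply: (@le_trans _ _ (\sum_(b' < w i) q i ^+ 2)).
      rewrite [leLHS]big_mkcond; apply: ler_sum => b' _; case: ifP => // _.
      exact: sqr_ge0.
    by rewrite sumr_const card_ord -[leLHS]mulr_natl.
  case: eqP => [<-|ff'].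
    apply: Ex_le; [exact: all_momentsM|exact: ms|move=> x].
    by rewrite selectedE; case: (_ == _); rewrite ?mulr1 ?mulr0.
  rewrite (_ : (fun x => _) = fun=> 0) ?Ex_cst//.
  apply/funext => x; rewrite !selectedE; case: eqP => [->|]; last by rewrite mul0r.
  by rewrite (introF eqP ff') mulr0.
apply: (le_trans (ler_sum _ (fun b _ => step b))).
rewrite big_split/= sumr_const card_ord; apply: lerD.
  by rewrite -[leLHS]mulr_natl mulrA -expr2.
case: ifP => _; last by rewrite big1.
by rewrite /Nsub Ex_sum.
Qed.

(** The counts add up to a constant, so centring each kernel at [8 * t3] centres the whole
    estimator. In [6 ^ 14 / n i], the [6 ^ 2] counts pairs of positions, [6 ^ 12] comes from
    [q ^+ 2], and [n i ^ 11] overlapping pairs meet [n i ^ 12] in its denominator. *)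
Lemma var_C1star :
  Ex P (fun x => (C1star TS X sig x - t3) ^+ 2) <=
  (8 * Wtot) ^- 2 * (cK * t2 ^+ 3 *
    (\sum_i (w i)%:R ^+ 2 * (6 ^+ 14 / (n i)%:R) + Wtot)).
Proof.
have W0 := Wtot_gt0.
pose g (s : Sub 5) x := hker Wobs (obs s) x - 8 * t3.
have ph (s : Sub 5) : pol P gen (inlS (obs_set s)) (hker Wobs (obs s)).
  by apply: (pol_hker pol_Wobs) => k; exact: obs_in.
have pg s : pol P gen (inlS (obs_set s)) (g s).
  by apply: polB; [exact: ph|exact: pol_cst].
rewrite (_ : (fun x => _) = fun x => (8 * Wtot) ^- 2 * (\sum_s Nsub s x * g s x) ^+ 2); last first.
  apply/funext => x; rewrite -exprVn -exprMn; congr (_ ^+ 2).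
  rewrite C1star_sum /g; under [in RHS]eq_bigr do rewrite mulrBr.
  rewrite sumrB -mulr_suml sum_Nsub mulrBr; congr (_ - _).
  by field; rewrite gt_eqF.
rewrite ExZ; last first.
  apply/all_momentsX/all_moments_sum => s _.
  exact: all_momentsM (pol_all_moments (pol_Nsub s)) (pol_all_moments (pg s)).
rewrite ler_pM2l ?invr_gt0 ?exprn_gt0 ?mulr_gt0//.
have t20 : 0 < t2 by exact: tr_projcov2_gt0.
have cK0 : 0 <= cK * t2 ^+ 3.
  by rewrite mulr_ge0 ?exprn_ge0 ?(ltW t20)// mulr_ge0 ?exprn_ge0 ?ler0n.
apply: le_trans (Ex_sqr_weighted_le gen_sub_meas gen_indep
  (good := fun s : Sub 5 => injectiveb (tagged s)) (ov := @overlap _ n 5)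
  (V := cK * t2 ^+ 3) pol_Nsub pg _ Nsub_ge0 Ex_Nsub2_bad _ _ _) _.
- by move=> s j; exact: inlS_sig.
- move=> s /obs_inj si; rewrite /g ExB; [|exact: mom_hker|exact: all_moments_cst].
  by have [-> _] := hker_moments si; rewrite Ex_cst subrr.
- move=> s /obs_inj si; have [h1 h2] := hker_moments si.
  by apply: le_trans h2; rewrite /g -h1; exact/Ex_center_sqr_le/mom_hker.
- by move=> s s'; exact: overlap_disj.
rewrite ler_wpM2l//.
apply: le_trans (sum_overlap_le (c := fun i => (w i)%:R ^+ 2 * q i ^+ 2)
  (r := fun s => Ex P (Nsub s)) _ _ Ex_Nsub2_le) _.
- by move=> i; rewrite mulr_ge0 ?sqr_ge0.
- by move=> s; apply: Ex_ge0 => x; exact: Nsub_ge0.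
rewrite sum_Ex_Nsub lerD2r; apply: ler_sum => i _.
rewrite -mulrA ler_wpM2l ?sqr_ge0// /q.
have n0 : (n i)%:R != 0 :> R by rewrite pnatr_eq0 -lt0n; apply: leq_trans (n6 i).
rewrite le_eqVlt; apply/orP; left; apply/eqP.
rewrite (_ : (5.+1 + 5)%N = 11)//; move: n0; move: ((n i)%:R : R) => z z0.
by field.
Qed.


(** * [A2] as a sum over all tuples with constant weights *)

Definition D4 (s : Sub 3) x : R :=
  Dker Wobs (obs s (o4 0)) (obs s (o4 1)) (obs s (o4 2)) (obs s (o4 3)) x.
Definition inj01 (s : Sub 3) : R := (injectiveb (tagged s))%:R.
Definition Q4 : R := \sum_i (n i ^_ 4)%:R.

Lemma sum_inj01 : \sum_s inj01 s = Q4.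
Proof.
rewrite sum_sub; apply: eq_bigr => i _; rewrite /inj01/= -natr_sum; congr (_%:R).
have := card_inj_ffuns 'I_4 'I_(n i); rewrite !card_ord => <-.
rewrite -sum1_card [RHS]big_mkcond; apply: eq_bigr => f _.
by rewrite !inE; case: injectiveb.
Qed.

Lemma Q4E : Q4 = 24 * \sum_i ('C(n i, 4))%:R.
Proof.
rewrite /Q4 mulr_sumr; apply: eq_bigr => i _.
by rewrite -bin_ffact natrM mulrC; congr (_ * _).
Qed.

Lemma Q4_ge : \sum_i (n i)%:R ^+ 4 <= 6 ^+ 4 * Q4.
Proof.
rewrite /Q4 mulr_sumr; apply: ler_sum => i _.
by rewrite -!natrX -natrM ler_nat expn_le_ffact.
Qed.

Lemma sum_n4_gt0 : 0 < \sum_i (n i)%:R ^+ 4 :> R.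
Proof.
have [i _] := index_nonempty.
rewrite (bigD1 i)//= ltr_wpDr//; first by apply: sumr_ge0 => k _; exact: exprn_ge0.
by rewrite exprn_gt0// ltr0n; apply: leq_trans (n6 i).
Qed.

Lemma Q4_gt0 : 0 < Q4.
Proof.
have := lt_le_trans sum_n4_gt0 Q4_ge.
by rewrite pmulr_rgt0// exprn_gt0.
Qed.

Lemma A2_sum x : A2 TS X x = (4 * Q4)^-1 * \sum_s inj01 s * D4 s x ^+ 2.
Proof.
pose F i (l1 l2 k1 k2 : 'I_(n i)) := Dker Wobs (Tagged (fun i => 'I_(n i)) l1)
  (Tagged (fun i => 'I_(n i)) l2) (Tagged (fun i => 'I_(n i)) k1)
  (Tagged (fun i => 'I_(n i)) k2) x ^+ 2.
have F1 i l1 l2 k1 k2 : @F i l1 l2 k1 k2 = F i l2 l1 k1 k2.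
  rewrite /F /Dker -[RHS]sqrrN -sumrN; congr (_ ^+ 2); apply: eq_bigr => p _.
  by rewrite /Wdiff; ring.
have F2 i l1 l2 k1 k2 : @F i l1 l2 k1 k2 = F i l1 l2 k2 k1.
  rewrite /F /Dker -[RHS]sqrrN -sumrN; congr (_ ^+ 2); apply: eq_bigr => p _.
  by rewrite /Wdiff; ring.
rewrite invfM mulrAC sum_sub.
rewrite (eq_bigr (fun i => 4 * \sum_(l1 < n i) \sum_(l2 < n i) \sum_(k1 < n i)
    \sum_(k2 < n i | [&& uniq [:: l1; l2; k1; k2], (l2 < l1)%N & (k2 < k1)%N]) F i l1 l2 k1 k2)).
  rewrite -mulr_sumr mulKf ?pnatr_eq0// mulrC Q4E /A2; congr (_ * _).
  apply: eq_bigr => i _; apply: eq_bigr => l1 _; apply: eq_bigr => l2 _.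
  apply: eq_bigr => k1 _; apply: eq_bigr => k2 _.
  by rewrite /F Dker_quadform.
by move=> i _; rewrite -(sum_inj4_sym (F1 i) (F2 i)).
Qed.

Lemma A2_ge0 x : 0 <= A2 TS X x.
Proof.
rewrite A2_sum mulr_ge0 ?invr_ge0 ?mulr_ge0 ?(ltW Q4_gt0)//.
by apply: sumr_ge0 => s _; rewrite mulr_ge0 ?sqr_ge0 ?ler0n.
Qed.

Lemma pol_D4 s : pol P gen (inlS (obs_set s)) (D4 s).
Proof. by apply: (pol_Dker pol_Wobs); exact: obs_in. Qed.

Lemma mom_A2 : all_moments P (A2 TS X).
Proof.
rewrite (funext A2_sum); apply/all_momentsZ/all_moments_sum => s _.
by apply/all_momentsZ/all_momentsX; exact: pol_all_moments (pol_D4 s).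
Qed.

(** The kernel is the square of a [Dker], so its second moment is a fourth moment. The factor 16
    counts pairs of positions, and [n i ^ 7] is [n i ^ 4] tuples times [n i ^ 3] partners per
    pair. *)
Lemma var_A2 :
  Ex P (fun x => (A2 TS X x - t2) ^+ 2) <=
  (4 * Q4) ^- 2 * ((4 + cK) * t2 ^+ 2 * (16 * \sum_i (n i)%:R ^+ 7)).
Proof.
have Q0 := Q4_gt0.
pose g (s : Sub 3) x := D4 s x ^+ 2 - 4 * t2.
have pg s : pol P gen (inlS (obs_set s)) (g s).
  by apply: polB; [apply: polX; exact: pol_D4|exact: pol_cst].
have pN s : pol P gen sigset (fun=> inj01 s) by exact: pol_cst.
have N0 s (x : T) : 0 <= inj01 s by exact: ler0n.
rewrite (_ : (fun x => _) = fun x => (4 * Q4) ^- 2 * (\sum_s inj01 s * g s x) ^+ 2); last first.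
  apply/funext => x; rewrite -exprVn -exprMn; congr (_ ^+ 2).
  rewrite A2_sum /g; under [in RHS]eq_bigr do rewrite mulrBr.
  rewrite sumrB -mulr_suml sum_inj01 mulrBr; congr (_ - _).
  by field; rewrite gt_eqF.
rewrite ExZ; last first.
  apply/all_momentsX/all_moments_sum => s _; apply: all_momentsZ.
  exact: pol_all_moments (pg s).
rewrite ler_pM2l ?invr_gt0 ?exprn_gt0 ?mulr_gt0//.
have t20 : 0 < t2 by exact: tr_projcov2_gt0.
have un (s : Sub 3) : injectiveb (tagged s) ->
    uniq [:: obs s (o4 0); obs s (o4 1); obs s (o4 2); obs s (o4 3)].
  rewrite injective4 => u; rewrite -(map_inj_uniq (f := Tagged (fun i => 'I_(n i)))) in u => //.
  by move=> k l /eqP; rewrite eq_Tagged => /eqP.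
have m2 s : all_moments P (fun x => D4 s x ^+ 2).
  by apply: all_momentsX; exact: pol_all_moments (pol_D4 s).
apply: le_trans (Ex_sqr_weighted_le gen_sub_meas gen_indep
  (good := fun s : Sub 3 => injectiveb (tagged s)) (ov := @overlap _ n 3)
  (V := (4 + cK) * t2 ^+ 2) pN pg _ N0 _ _ _ _) _.
- by move=> s j; exact: inlS_sig.
- by move=> s ns s'; rewrite /inj01 (negbTE ns) Ex_cst mul0r.
- move=> s /un u; have [h1 _] := Dker_moments u.
  by rewrite /g ExB//; [rewrite h1 Ex_cst subrr|exact: all_moments_cst].
- move=> s /un u; have [h1 h2] := Dker_moments u.
  apply: le_trans h2; rewrite /g -h1; apply: le_trans (Ex_center_sqr_le (m2 s)) _.
  by rewrite le_eqVlt; apply/orP; left; apply/eqP; congr Ex; apply/funext => x; rewrite -exprM.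
- by move=> s s'; exact: overlap_disj.
have cK0 : 0 <= cK by rewrite mulr_ge0 ?exprn_ge0 ?ler0n.
rewrite ler_wpM2l ?mulr_ge0 ?sqr_ge0 ?addr_ge0 ?(ltW t20)//.
(* The weights are at most 1, so [c = 1] covers the diagonal as well. *)
have H (s s' : Sub 3) : overlap s s' ->
    Ex P (fun=> inj01 s * inj01 s') <= 1 + (if s == s' then 0 else 0).
  move=> _; rewrite Ex_cst if_same addr0 /inj01.
  by do 2 case: injectiveb; rewrite ?mulr0 ?mul0r ?mulr1.
apply: le_trans (sum_overlap_le (c := fun=> 1) (r := fun=> 0) _ _ H) _ => //.
rewrite [X in _ + X]big1// addr0 mulr_sumr; apply: ler_sum => i _.
by rewrite mul1r ler_wpM2r ?exprn_ge0// -natrX ler_nat.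
Qed.

End Model.

(** * Asymptotics *)

Section Asymptotics.
Context {R : realType}.

(** On the scale [r = t2 ^ (3 / 2)] the numerator is off by at most [3 * de] and the denominator by
    [5 * de], relative to [t2 ^+ 3]. As [de <= 1 / 2] keeps [A >= t2 / 2], dividing by [A ^+ 3]
    costs a factor 8, and [8 * (3 + 5) = 64]. *)
Lemma ratio_dist_le (C A t2 t3 e de : R) : 0 < t2 -> t3 ^+ 2 <= t2 ^+ 3 ->
  0 <= e <= 1 -> 0 < de -> de <= 2^-1 ->
  (C - t3) ^+ 2 < de ^+ 2 * t2 ^+ 3 -> (A - t2) ^+ 2 < de ^+ 2 * t2 ^+ 2 ->
  `|e * (C ^+ 2 / A ^+ 3) - e * (t3 ^+ 2 / t2 ^+ 3)| <= 64 * de.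
Proof.
move=> t20 t32 /andP[e0 e1] d0 d1 hC hA.
pose r := Num.sqrt (t2 ^+ 3).
have t230 : 0 < t2 ^+ 3 by rewrite exprn_gt0.
have r0 : 0 < r by rewrite sqrtr_gt0.
have r2 : r ^+ 2 = t2 ^+ 3 by rewrite sqr_sqrtr// ltW.
have ht3 : `|t3| <= r.
  by rewrite -ler_sqr ?nnegrE ?(ltW r0)// real_normK ?num_real// r2.
have hC' : `|C - t3| <= de * r.
  rewrite -ler_sqr ?nnegrE ?mulr_ge0 ?(ltW r0) ?(ltW d0)// real_normK ?num_real//.
  by rewrite exprMn r2 ltW.
have hA' : `|A - t2| <= de * t2.
  rewrite -ler_sqr ?nnegrE ?mulr_ge0 ?(ltW t20) ?(ltW d0)// real_normK ?num_real//.
  by rewrite exprMn ltW.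
have dt : de * t2 <= 2^-1 * t2 by rewrite ler_pM2r.
have Alb : 2^-1 * t2 <= A by move: hA'; rewrite ler_distl => /andP[]; lra.
have Aub : A <= 3 / 2 * t2 by move: hA'; rewrite ler_distl => /andP[]; lra.
have A0 : 0 < A by apply: lt_le_trans Alb; rewrite mulr_gt0.
have A3 : t2 ^+ 3 <= 8 * A ^+ 3.
  have -> : 8 * A ^+ 3 = (2 * A) ^+ 3 by ring.
  have h : t2 <= 2 * A by lra.
  by rewrite lerXn2r// nnegrE ?mulr_ge0// ltW.
have num1 : `|C ^+ 2 - t3 ^+ 2| <= 3 * de * t2 ^+ 3.
  have -> : C ^+ 2 - t3 ^+ 2 = (C - t3) * ((C - t3) + 2 * t3) by ring.
  rewrite normrM -r2 (_ : 3 * de * r ^+ 2 = (de * r) * (3 * r)); last by ring.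
  apply: ler_pM => //; apply: le_trans (ler_normD _ _) _.
  rewrite normrM (ger0_norm (_ : 0 <= 2)); last exact: ler0n.
  have : de * r <= 2^-1 * r by rewrite ler_pM2r.
  by lra.
have num2 : `|A ^+ 3 - t2 ^+ 3| <= 5 * de * t2 ^+ 3.
  have -> : A ^+ 3 - t2 ^+ 3 = (A - t2) * (A ^+ 2 + A * t2 + t2 ^+ 2) by ring.
  rewrite normrM (_ : 5 * de * t2 ^+ 3 = (de * t2) * (5 * t2 ^+ 2)); last by ring.
  apply: ler_pM => //; rewrite ger0_norm; last by rewrite !addr_ge0 ?sqr_ge0// mulr_ge0 ?ltW.
  have : A * A <= (3 / 2 * t2) * (3 / 2 * t2) by apply: ler_pM => //; exact: ltW.
  have : A * t2 <= 3 / 2 * t2 * t2 by rewrite ler_pM2r.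
  have : 0 < t2 * t2 by rewrite mulr_gt0.
  by rewrite !expr2; lra.
rewrite -mulrBr normrM (ger0_norm e0).
apply: (@le_trans _ _ `|C ^+ 2 / A ^+ 3 - t3 ^+ 2 / t2 ^+ 3|); first by rewrite ler_piMl.
have A30 : 0 < A ^+ 3 by rewrite exprn_gt0.
have -> : C ^+ 2 / A ^+ 3 - t3 ^+ 2 / t2 ^+ 3 =
    ((C ^+ 2 - t3 ^+ 2) * t2 ^+ 3 - t3 ^+ 2 * (A ^+ 3 - t2 ^+ 3)) / (A ^+ 3 * t2 ^+ 3).
  by field; rewrite !gt_eqF.
rewrite normrM normfV (ger0_norm (ltW (mulr_gt0 A30 t230))) ler_pdivrMr ?mulr_gt0//.
apply: le_trans (ler_normB _ _) _.
rewrite (normrM _ (t2 ^+ 3)) (normrM (t3 ^+ 2)) (ger0_norm (ltW t230)) (ger0_norm (sqr_ge0 t3)).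
move: A3 num1 num2 t32 A30 t230.
move: (A ^+ 3) (t2 ^+ 3) (t3 ^+ 2) (sqr_ge0 t3) (`|C ^+ 2 - _|) => a b c c0 u A3.
move: (`|a - b|) (normr_ge0 (a - b)) => v v0 num1 num2 cb a0 b0.
have h1 : u * b <= 3 * de * b * b by rewrite ler_pM2r.
have h2 : c * v <= b * (5 * de * b) by apply: ler_pM.
have h3 : 8 * de * b * b <= 8 * de * b * (8 * a) by rewrite ler_pM2l// !mulr_gt0.
by lra.
Qed.

Lemma sum_sqr_le_sqr_sum (I : finType) (x : I -> R) : (forall i, 0 <= x i) ->
  \sum_i x i ^+ 2 <= (\sum_i x i) ^+ 2.
Proof.
move=> x0; rewrite expr2 mulr_suml; apply: ler_sum => i _.
by rewrite expr2 ler_wpM2l// (bigD1 i)//= lerDl sumr_ge0.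
Qed.

(* Indices with [K <= n i] contribute to the first term, the others to the second. *)
Lemma sum_sqr_div_le (I : finType) (n : I -> nat) (x : I -> R) (c : R) (K : nat) :
  (0 < K)%N -> (forall i, 0 < n i)%N -> 0 <= c ->
  (forall i, 0 <= x i) -> (forall i, x i <= c * (n i)%:R ^+ 6) ->
  \sum_i x i ^+ 2 / (n i)%:R <= (\sum_i x i) ^+ 2 / K%:R + c * K%:R ^+ 6 * \sum_i x i.
Proof.
move=> K0 n0 c0 x0 xc.
apply: (@le_trans _ _ (\sum_i (x i ^+ 2 / K%:R + c * K%:R ^+ 6 * x i))).
  apply: ler_sum => i _; have [Kn|nK] := leqP K (n i).
    apply: (@le_trans _ _ (x i ^+ 2 / K%:R)); last by rewrite lerDl !mulr_ge0 ?exprn_ge0.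
    by rewrite ler_wpM2l ?sqr_ge0// lef_pV2 ?posrE ?ltr0n// ler_nat.
  apply: (@le_trans _ _ (c * K%:R ^+ 6 * x i)); last first.
    by rewrite lerDr divr_ge0 ?sqr_ge0.
  apply: (@le_trans _ _ (x i ^+ 2)).
    by rewrite ler_pdivrMr ?ltr0n// ler_peMr ?sqr_ge0// ler1n.
  rewrite expr2 ler_wpM2r//; apply: le_trans (xc i) _.
  by rewrite ler_wpM2l// lerXn2r ?nnegrE// ler_nat ltnW.
by rewrite big_split/= -mulr_suml -mulr_sumr lerD2r ler_wpM2r ?invr_ge0// sum_sqr_le_sqr_sum.
Qed.

(** First [K] is fixed to make [1 / K] at most [eps / 2], then a large total absorbs the term with
    [K ^ 6]. The threshold depends on [c] and [eps] alone, so it holds uniformly while the number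
    and sizes of the groups vary. It is used with [x i = w_i] and with [x i = n_i ^ 4]. *)
Lemma sum_sqr_div_small (c eps : R) : 0 <= c -> 0 < eps -> exists N : nat,
  forall (I : finType) (n : I -> nat) (x : I -> R),
  (forall i, 0 < n i)%N -> (forall i, 0 <= x i) -> (forall i, x i <= c * (n i)%:R ^+ 6) ->
  N%:R <= \sum_i x i -> 0 < \sum_i x i ->
  (\sum_i x i ^+ 2 / (n i)%:R) / (\sum_i x i) ^+ 2 <= eps.
Proof.
move=> c0 e0.
pose K := (Num.bound (2 / eps)).+1.
have hK : K%:R^-1 <= eps / 2.
  rewrite -[leRHS]invrK lef_pV2 ?posrE ?invr_gt0 ?divr_gt0 ?ltr0n// invf_div.
  apply: le_trans (ltW (archi_boundP _)) _; first by rewrite divr_ge0 ?ltW.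
  by rewrite ler_nat.
pose b := c * K%:R ^+ 6 * (2 / eps).
have b0 : 0 <= b by rewrite /b !mulr_ge0 ?exprn_ge0 ?invr_ge0 ?(ltW e0).
exists (Num.bound b) => I n x n0 x0 xc.
set S := \sum_i x i => hN S0.
have hS : b <= S by apply: le_trans hN; exact/ltW/archi_boundP.
rewrite ler_pdivrMr ?exprn_gt0//.
apply: le_trans (sum_sqr_div_le (ltn0Sn _) n0 c0 x0 xc) _; rewrite -/S -/K.
have h1 : S ^+ 2 / K%:R <= S ^+ 2 * (eps / 2) by rewrite ler_wpM2l ?sqr_ge0.
have h2 : c * K%:R ^+ 6 * S <= eps / 2 * S * S.
  rewrite ler_pM2r//; apply: le_trans (_ : eps / 2 * b <= _).
    rewrite /b le_eqVlt; apply/orP; left; apply/eqP.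
    by move: (c * _) => z; field; rewrite gt_eqF.
  by rewrite ler_pM2l ?divr_gt0.
by apply: le_trans (lerD h1 h2) _; rewrite expr2; lra.
Qed.

Lemma wsub_le (ups : R) a (n : 'I_a -> nat) i : 0 < ups -> (0 < n i)%N ->
  (wsub ups n i)%:R <= (ups + 1) * (n i)%:R ^+ 6.
Proof.
move=> u0 n0; rewrite /wsub.
set y := ups * _; have y0 : 0 <= y by apply: mulr_ge0; [exact: ltW|exact: ler0n].
have c0 : 0 <= Num.ceil y by rewrite ceil_ge0 (lt_le_trans _ y0)// ltrN10.
have -> : (absz (Num.ceil y))%:R = (Num.ceil y)%:~R :> R.
  by rewrite natr_absz ger0_norm.
have /andP[h _] := ceil_itv y.
have h' : (Num.ceil y)%:~R <= y + 1 by move: h; rewrite intrB => /ltW; rewrite lerBlDr.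
apply: le_trans h' _; rewrite mulrDl mul1r; apply: lerD.
  rewrite ler_pM2l// -natrX ler_nat.
  have : ('C(n i, 6) * 6`! <= n i ^ 6)%N.
    rewrite bin_ffact; elim: (6)%N => [|k ih]; first by rewrite ffactn0.
    by rewrite ffactnSr expnSr leq_mul// leq_subr.
  by apply: leq_trans; rewrite leq_pmulr// fact_gt0.
by rewrite exprn_ege1// ler1n.
Qed.


End Asymptotics.

(** * Deviation probability for a single model *)

Section SingleModelBound.
Context {R : realType} {dT : measure_display} {T : measurableType dT}.
Variables (P : probability T R) (a d : nat) (n : 'I_a -> nat)
  (mu : 'I_a -> 'cV[R]_d) (Sig TS : 'M[R]_d) (TW : 'M[R]_a) (ups : R).
Unset Implicit Arguments.
Variable X : forall i : 'I_a, 'I_(n i) -> 'I_d -> T -> R.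
Variable sig : forall i : 'I_a, 'I_(wsub ups n i) -> T -> {ffun 'I_6 -> 'I_(n i)}.
Set Implicit Arguments.
Hypothesis model : model_hyp P mu Sig TS TW X sig.

(* Since [0^-1 = 0], this also holds where [C1star] or [A2] vanishes. *)
Lemma fPhat_star_inv t :
  (fPhat_star TS X sig TW t)^-1 =
  (eta_Na n TW)^-1 * (C1star TS X sig t ^+ 2 / A2 TS X t ^+ 3).
Proof. by rewrite /fPhat_star invfM invf_div mulrC. Qed.

Lemma measurable_fPhat_event (eps : R) :
  measurable [set t | eps < `|(fPhat_star TS X sig TW t)^-1 - (fP n TW TS Sig)^-1|].
Proof.
(* [A2] is nonnegative, and there the measurable power with exponent -1 is the inverse, including
   the value 0 at 0. *)
pose h t := `|(eta_Na n TW)^-1 * (C1star TS X sig t ^+ 2 * (A2 TS X t `^ (-1)) ^+ 3) -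
  (fP n TW TS Sig)^-1|.
have mh : measurable_fun setT h.
  apply: measurableT_comp; first exact: normr_measurable.
  apply: measurable_funB; last exact: measurable_cst.
  apply: measurable_funM; first exact: measurable_cst.
  apply: measurable_funM; apply: measurable_funX.
    exact: all_moments_measurable (mom_C1star model).
  apply: (measurableT_comp (measurable_powR (-1))).
  exact: all_moments_measurable (mom_A2 model).
rewrite (_ : [set t | _] = h @^-1` `]eps, +oo[).
  by rewrite -[_ @^-1` _]setTI; exact: mh.
apply/seteqP; split => t /=; rewrite in_itv/= andbT fPhat_star_inv /h powR_inv1 ?exprVn//;
  exact: (A2_ge0 model).
Qed.

(** Bounds the variance of [C1star] divided by [t2 ^+ 3]. *)
Definition C1_bound : R :=
  cK / 64 * (6 ^+ 14 * ((\sum_i (wsub ups n i)%:R ^+ 2 / (n i)%:R) / Wtot n ups ^+ 2) +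
             (Wtot n ups)^-1).
(** Bounds the variance of [A2] divided by [t2 ^+ 2]. Writing [n_i ^ 7] as [(n_i ^ 4) ^ 2 / n_i]
    gives it the shape of [sum_sqr_div_small]. *)
Definition A2_bound : R :=
  (4 + cK) * (6 ^+ 8 * ((\sum_i ((n i)%:R ^+ 4) ^+ 2 / (n i)%:R) / (\sum_i (n i)%:R ^+ 4) ^+ 2)).

Let n6 i : (6 <= n i)%N. Proof. by have [[+ _ _ _ _] _] := model; apply. Qed.
Let hTW : sym_idem_nz TW. Proof. by have [[_ _ + _ _] _] := model. Qed.
Let hTS : sym_idem_nz TS. Proof. by have [[_ _ _ + _] _] := model. Qed.
Let hSig : posdef Sig. Proof. by have [[_ _ _ _ +] _] := model. Qed.

(** Chebyshev's inequality for each estimator and a union bound; off the two exceptional events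
    [ratio_dist_le] applies. *)
Lemma fPhat_star_prob_le (eps de : R) : 0 < de -> de <= 2^-1 -> 64 * de <= eps ->
  (P [set t | (eps < `|(fPhat_star TS X sig TW t)^-1 - (fP n TW TS Sig)^-1|)%R] <=
   (de ^- 2 * (C1_bound + A2_bound))%:E)%E.
Proof.
move=> d0 d1 de_eps.
set M := projcov TS Sig; set t2 := \tr (M *m M); set t3 := \tr (M *m M *m M).
have t20 : 0 < t2 by exact: tr_projcov2_gt0.
have W0 := Wtot_gt0 model; have Q0 : 0 < Q4 n :> R := Q4_gt0 model.
have S0 := sum_n4_gt0 model.
pose f1 t := (C1star TS X sig t - t3) ^+ 2.
pose f2 t := (A2 TS X t - t2) ^+ 2.
have m1 : all_moments P f1.
  by apply/all_momentsX/all_momentsB; [exact: mom_C1star model|exact: all_moments_cst].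
have m2 : all_moments P f2.
  by apply/all_momentsX/all_momentsB; [exact: mom_A2 model|exact: all_moments_cst].
pose c1 := de ^+ 2 * t2 ^+ 3; pose c2 := de ^+ 2 * t2 ^+ 2.
have c10 : 0 < c1 by rewrite mulr_gt0 ?exprn_gt0.
have c20 : 0 < c2 by rewrite mulr_gt0 ?exprn_gt0.
have mlev (f : T -> R) (c : R) : all_moments P f -> measurable [set x | (c <= f x)%R].
  move=> /all_moments_measurable mf.
  rewrite (_ : [set x | _] = f @^-1` `[c, +oo[); last first.
    by apply/seteqP; split => x /=; rewrite in_itv/= andbT.
  by rewrite -[_ @^-1` _]setTI; exact: mf.
have mE1 := mlev f1 c1 m1; have mE2 := mlev f2 c2 m2.
apply: (@le_trans _ _ (P ([set x | (c1 <= f1 x)%R] `|` [set x | (c2 <= f2 x)%R]))).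
  apply: le_measure; rewrite ?inE; [exact: measurable_fPhat_event|exact: measurableU|].
  move=> t /= h; apply/orP; rewrite -[_ || _]negbK negb_or -!ltNge.
  apply/negP => /andP[h1 h2]; move: h; apply/negP; rewrite -leNgt.
  apply: le_trans de_eps; rewrite fPhat_star_inv (fP_inv Sig hTS).
  apply: ratio_dist_le => //.
    exact/tr3_sqr_le/projcov_sym.
  by apply: eta_Na_inv_bounds; have [] := hTW.
apply: (le_trans (measureU2 _ mE1 mE2)).
rewrite mulrDr EFinD; apply: leeD.
  apply: (le_trans (markov_ineq m1 (fun x => sqr_ge0 _) c10)).
  rewrite lee_fin.
  apply: (le_trans (ler_wpM2l _ (var_C1star model))); first by rewrite invr_ge0 ltW.
  rewrite le_eqVlt; apply/orP; left; apply/eqP; rewrite /c1 /C1_bound -/M -/t2.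
  rewrite (_ : \sum_i _ = 6 ^+ 14 * \sum_i (wsub ups n i)%:R ^+ 2 / (n i)%:R); last first.
    by rewrite mulr_sumr; apply: eq_bigr => i _; rewrite mulrCA mulrA.
  move: (\sum_i _) (6 ^+ 14) (cK : R) => z y c.
  by field; rewrite !gt_eqF.
apply: (le_trans (markov_ineq m2 (fun x => sqr_ge0 _) c20)).
rewrite lee_fin.
apply: (le_trans (ler_wpM2l _ (var_A2 model))); first by rewrite invr_ge0 ltW.
rewrite /c2 /A2_bound -/M -/t2.
rewrite [X in _ <= _ * (_ * (_ * (X / _)))](_ : _ = \sum_i (n i)%:R ^+ 7); last first.
  apply: eq_bigr => i _; have ni : (n i)%:R != 0 :> R.
    by rewrite pnatr_eq0 -lt0n; apply: leq_trans (n6 i).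
  by move: ni; move: ((n i)%:R : R) => z z0; field.
have := Q4_ge model; have : 0 <= \sum_i (n i)%:R ^+ 7 :> R.
  by apply: sumr_ge0 => i _; exact: exprn_ge0.
have : 0 <= 4 + cK :> R by rewrite addr_ge0// mulr_ge0 ?exprn_ge0 ?ler0n.
move: (\sum_i (n i)%:R ^+ 7) (4 + cK : R) => z c c0 z0.
move: S0; move: (\sum_i (n i)%:R ^+ 4) => S S0 SQ.
rewrite (_ : (de ^+ 2 * t2 ^+ 2)^-1 * _ = de ^- 2 * (c * (z * Q4 n ^- 2))); last first.
  by field; rewrite !gt_eqF.
rewrite ler_wpM2l ?invr_ge0 ?exprn_ge0 ?(ltW d0)//.
rewrite ler_wpM2l// mulrCA ler_wpM2l//.
rewrite (_ : 6 ^+ 8 / S ^+ 2 = (S / 6 ^+ 4) ^- 2); last first.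
  by rewrite expr_div_n invf_div -exprM.
rewrite lef_pV2 ?posrE ?exprn_gt0 ?divr_gt0 ?exprn_gt0//.
rewrite lerXn2r// ?nnegrE ?(ltW Q0) ?divr_ge0 ?exprn_ge0 ?(ltW S0)//.
by rewrite ler_pdivrMr ?exprn_gt0// mulrC.
Qed.

End SingleModelBound.

(** * Smallness of the variance bounds for a large number of draws *)

Section Bounds.
Context {R : realType}.

Lemma cK_ge0 : 0 <= cK :> R.
Proof. by rewrite mulr_ge0 ?exprn_ge0 ?ler0n. Qed.

Lemma C1_bound_small (ups eps : R) : 0 < ups -> 0 < eps -> exists N : nat,
  forall a (n : 'I_a -> nat), (forall i, 6 <= n i)%N ->
  N%:R <= Wtot n ups -> 0 < Wtot n ups -> C1_bound n ups <= eps.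
Proof.
move=> u0 e0; rewrite /C1_bound; have := cK_ge0; have : 0 <= 6 ^+ 14 :> R by rewrite exprn_ge0.
(* Only the signs of the numerical constants matter from here on. *)
move: (6 ^+ 14) (cK) => y c y0 c0.
pose e' := eps / (c / 64 + 1) / 2.
have k0 : 0 < c / 64 + 1 by rewrite ltr_wpDl ?divr_ge0.
have e'0 : 0 < e' by rewrite !divr_gt0.
have ye0 : 0 < e' / (y + 1) by rewrite divr_gt0// ltr_wpDl.
have [|N1 h1] := @sum_sqr_div_small R (ups + 1) (e' / (y + 1)) _ ye0.
  by rewrite addr_ge0// ltW.
exists (maxn N1 (Num.bound e'^-1)) => a n n6 hN W0.
have n0 i : (0 < n i)%N by apply: leq_trans (n6 i).
have := h1 _ n (fun i => (wsub ups n i)%:R) n0 (fun i => ler0n _ _) (fun i => wsub_le u0 (n0 i)).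
rewrite -/(Wtot n ups) => /(_ _ W0)/wrap[].
  by apply: le_trans hN; rewrite ler_nat leq_maxl.
move=> hz; have hW : (Wtot n ups)^-1 <= e'.
  rewrite -[leRHS]invrK lef_pV2 ?posrE ?invr_gt0//.
  apply: le_trans (ltW (archi_boundP _)) _; first by rewrite invr_ge0 ltW.
  by apply: le_trans hN; rewrite ler_nat leq_maxr.
move: hz; set z := (_ / _ ^+ 2) => hz.
have h2 : y * z <= e'.
  apply: (@le_trans _ _ (y * (e' / (y + 1)))); first by rewrite ler_wpM2l.
  rewrite mulrCA ler_piMr ?(ltW e'0)// ler_pdivrMr ?mul1r ?lerDl//.
  by rewrite ltr_wpDl.
apply: (@le_trans _ _ (c / 64 * (e' + e'))).
  by rewrite ler_wpM2l ?divr_ge0// lerD.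
apply: (@le_trans _ _ ((c / 64 + 1) * (e' + e'))).
  by rewrite ler_wpM2r ?addr_ge0 ?(ltW e'0)// lerDl.
rewrite le_eqVlt; apply/orP; left; apply/eqP; rewrite /e'.
by move: k0; move: (c / 64 + 1) => k k0; field; rewrite gt_eqF.
Qed.

(** The total number of draws controls the sample sizes: [w_i <= (ups + 1) * n_i ^ 6 <= (ups + 1) *
    n_i ^ 8], hence [Wtot <= (ups + 1) * S ^+ 2], and [S] is large whenever [Wtot] is. *)
Lemma A2_bound_small (ups eps : R) : 0 < ups -> 0 < eps -> exists N : nat,
  forall a (n : 'I_a -> nat), (forall i, 6 <= n i)%N ->
  N%:R <= Wtot n ups -> 0 < Wtot n ups -> A2_bound n <= eps.
Proof.
move=> u0 e0; rewrite /A2_bound.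
have : 0 < (4 + cK) * 6 ^+ 8 :> R.
  by rewrite mulr_gt0 ?exprn_gt0// ltr_pwDl ?cK_ge0.
move=> k0.
pose k : R := (4 + cK) * 6 ^+ 8.
have ke0 : 0 < eps / k by rewrite divr_gt0.
have [|N1 h1] := @sum_sqr_div_small R 1 (eps / k) _ ke0; first exact: ler01.
pose b := (ups + 1) * (N1%:R + 1) ^+ 2.
have u1 : 0 < ups + 1 by rewrite addr_gt0.
have b0 : 0 <= b by rewrite mulr_ge0 ?sqr_ge0 ?(ltW u1).
exists (Num.bound b) => a n n6 hN W0.
have n0 i : (0 < n i)%N by apply: leq_trans (n6 i).
have WS : Wtot n ups <= (ups + 1) * (\sum_i (n i)%:R ^+ 4) ^+ 2.
  apply: (@le_trans _ _ ((ups + 1) * \sum_i ((n i)%:R ^+ 4) ^+ 2)).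
    rewrite mulr_sumr; apply: ler_sum => i _.
    apply: le_trans (wsub_le u0 (n0 i)) _; rewrite ler_pM2l// -exprM.
    by apply: ler_weXn2l; rewrite ?ler1n.
  by rewrite ler_pM2l//; apply: sum_sqr_le_sqr_sum => i; exact: exprn_ge0.
set S : R := \sum_i (n i)%:R ^+ 4 in WS *.
have S0 : 0 <= S by apply: sumr_ge0 => i _; exact: exprn_ge0.
have NS : N1%:R + 1 <= S.
  rewrite -ler_sqr ?nnegrE ?addr_ge0// -(ler_pM2l u1).
  by apply: le_trans WS; apply: le_trans hN; exact/ltW/archi_boundP.
have Sp : 0 < S by apply: lt_le_trans NS; rewrite ltr_wpDl.
have x6 i : (n i)%:R ^+ 4 <= 1 * (n i)%:R ^+ 6 :> R.
  by rewrite mul1r; apply: ler_weXn2l; rewrite ?ler1n.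
have := h1 _ n (fun i => (n i)%:R ^+ 4) n0 (fun i => exprn_ge0 _ (ler0n _ _)) x6.
rewrite -/S => /(_ _ Sp)/wrap[]; first by apply: le_trans NS; rewrite lerDl.
by move=> h; rewrite [leLHS]mulrA -/k [leLHS]mulrC -ler_pdivlMr.
Qed.

End Bounds.

Theorem theorem5 (R : realType) :
  (* (a) unbiasedness of C_1^star, for every single model *)
  (forall (dT : measure_display) (T : measurableType dT) (P : probability T R)
     (a d : nat) (n : 'I_a -> nat) (mu : 'I_a -> 'cV[R]_d)
     (Sig TS : 'M[R]_d) (TW : 'M[R]_a) (ups : R)
     (X : forall i : 'I_a, 'I_(n i) -> 'I_d -> T -> R)
     (sig : forall i : 'I_a, 'I_(wsub ups n i) -> T -> {ffun 'I_6 -> 'I_(n i)}),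
     model_hyp P mu Sig TS TW X sig ->
     ('E_P[C1star TS X sig] =
        (\tr ((TS *m Sig) *m (TS *m Sig) *m (TS *m Sig)))%:E)%E) /\
  (* (b) ratio-consistency of \hat f_P^star along a sequence of models (index k)
     in any of the frameworks (I)-(V) *)
  (forall (F : framework) (ups : R)
     (dT : nat -> measure_display) (T : forall k, measurableType (dT k))
     (P : forall k, probability (T k) R)
     (a d : nat -> nat) (n : forall k, 'I_(a k) -> nat)
     (mu : forall k, 'I_(a k) -> 'cV[R]_(d k))
     (Sig TS : forall k, 'M[R]_(d k)) (TW : forall k, 'M[R]_(a k))
     (X : forall k (i : 'I_(a k)), 'I_(n k i) -> 'I_(d k) -> T k -> R)
     (sig : forall k (i : 'I_(a k)),
        'I_(wsub ups (n k) i) -> T k -> {ffun 'I_6 -> 'I_(n k i)}),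
     (forall k, model_hyp (P k) (mu k) (Sig k) (TS k) (TW k) (X k) (sig k)) ->
     diverges (fun k => \sum_(i < a k) wsub ups (n k) i)%N ->
     in_framework F a d (fun k => nmax (n k)) ->
     forall eps : R, 0 < eps ->
       (fun k => P k [set t | eps <
          `| (fPhat_star (TS k) (X k) (sig k) (TW k) t)^-1
             - (fP (n k) (TW k) (TS k) (Sig k))^-1 |]) @ \oo --> 0%E).
Proof.
split.
  move=> dT T P a d n mu Sig TS TW ups X sig model.
  have hTS : sym_idem_nz TS by have [[_ _ _ + _] _] := model.
  rewrite unlock (EFin_Ex (mom_C1star model)) (Ex_C1star model).
  by rewrite (tr_projcov3 Sig hTS).
move=> F ups dT T P a d n mu Sig TS TW X sig model Wdiv _ eps e0.
(* The largest accuracy that [ratio_dist_le] admits and that yields a deviation of at most [eps]. *)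
pose de := Num.min 2^-1 (eps / 64).
have d0 : 0 < de by rewrite lt_min invr_gt0 ltr0n divr_gt0.
have d1 : de <= 2^-1 by rewrite ge_min lexx.
have d2 : 64 * de <= eps by rewrite mulrC -ler_pdivlMr// ge_min lexx orbT.
have u0 : 0 < ups by have [[_ + _ _ _] _] := model 0%N.
pose B k := de ^- 2 * (C1_bound (n k) ups + A2_bound (n k)).
apply: (@squeeze_cvge _ _ _ _ (fun=> 0%E) _ (EFin \o B)).
- near=> k; rewrite measure_ge0/=.
  exact: (fPhat_star_prob_le (model k) d0 d1 d2).
- exact: cvg_cst.
have Bge0 k : 0 <= B k.
  rewrite mulr_ge0 ?invr_ge0 ?exprn_ge0 ?(ltW d0)// /C1_bound /A2_bound addr_ge0//.
    rewrite mulr_ge0 ?divr_ge0 ?cK_ge0// addr_ge0 ?invr_ge0 ?(ltW (Wtot_gt0 (model k)))//.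
    rewrite mulr_ge0 ?exprn_ge0// divr_ge0 ?sqr_ge0//.
    by apply: sumr_ge0 => i _; rewrite divr_ge0 ?sqr_ge0.
  rewrite mulr_ge0 ?addr_ge0 ?cK_ge0// mulr_ge0 ?exprn_ge0// divr_ge0 ?sqr_ge0//.
  by apply: sumr_ge0 => i _; rewrite divr_ge0 ?sqr_ge0.
apply: cvg_EFin; first by near=> k.
apply/cvgr0Pnorm_le => e e_gt0.
(* Each of the two bounds may take half of [e] after multiplication by [de ^- 2]. *)
have e'0 : 0 < e * de ^+ 2 / 2 by rewrite divr_gt0// mulr_gt0// exprn_gt0.
have [N1 h1] := C1_bound_small u0 e'0; have [N2 h2] := A2_bound_small u0 e'0.
have WN k : Wtot (n k) ups = (\sum_(i < a k) wsub ups (n k) i)%N%:R.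
  by rewrite /Wtot natr_sum.
near=> k.
have n6 i : (6 <= n k i)%N by have [[+ _ _ _ _] _] := model k; apply.
have W0 := Wtot_gt0 (model k).
have NW : ((N1 + N2)%N <= \sum_(i < a k) wsub ups (n k) i)%N.
  by near: k; exact: Wdiv.
have b1 := h1 _ _ n6 ltac:(by rewrite WN ler_nat (leq_trans _ NW)// leq_addr) W0.
have b2 := h2 _ _ n6 ltac:(by rewrite WN ler_nat (leq_trans _ NW)// leq_addl) W0.
rewrite /= ger0_norm// /B mulrC ler_pdivrMr ?exprn_gt0//.
by lra.
Unshelve. all: by end_near. Qed.
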